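(* Let $\mathbb{K}$ be a field, $n\ge 2$, $R=\mathbb{K}[x_1,\dots,x_n]$, and let $J(G)\subseteq R$ be the cover ideal of a simple connected graph $G$ on the vertex set $\{x_1,\dots,x_n\}$. Let $x_n$ be a vertex of degree $n-1$. Then the Lyubeznik table of $R/J(G)$ is trivial.
   Context: Cover ideal: $J(G)=\bigcap_{\{x_i,x_j\}\in E_G}(x_i,x_j)\subseteq R$, where $E_G$ is the edge set of $G$. Lyubeznik numbers: for a squarefree monomial ideal $J\subseteq R$ with $\mathfrak m=(x_1,\dots,x_n)$, $\lambda_{p,i}(R/J):=\mu_p(\mathfrak m,H^{n-i}_J(R))$, the $p$-th Bass number of $H_J^{n-i}(R)$ with respect to $\mathfrak m$. They vanish unless $0\le p\le i\le d=\dim R/J$. The Lyubeznik table $(\lambda_{p,i}(R/J))_{0\le p\le i\le d}$ is trivial if $\lambda_{d,d}(R/J)=1$ and all other $\lambda_{p,i}(R/J)$ vanish. *)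

(* Defs.v *)
From HB Require Import structures.
From mathcomp Require Import all_boot all_order all_algebra.
(* [functions] equips [T -> V] with its pointwise [lmodType] structure *)
From mathcomp Require Import functions.
From mathcomp Require Import mpoly.

Set Implicit Arguments.
Unset Strict Implicit.
Unset Printing Implicit Defensive.

Import GRing.Theory.
Local Open Scope ring_scope.

(* Ideals of a ring and submodules of a module are [Prop]-valued predicates. *)

Section Ideals.
Variable A : comNzRingType.
Implicit Types (I J : A -> Prop) (s : seq A).

Definition span_ideal s : A -> Prop :=
  fun f => exists c : nat -> A, f = \sum_(i < size s) c i * s`_i.

Definition mul_ideal I J : A -> Prop :=
  fun f => exists2 s : seq (A * A),
    forall u, u \in s -> I u.1 /\ J u.2 & f = \sum_(u <- s) u.1 * u.2.

Fixpoint pow_ideal J (k : nat) : A -> Prop :=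
  if k is k'.+1 then mul_ideal J (pow_ideal J k') else fun _ => True.

Definition is_prime_ideal (P : A -> Prop) : Prop :=
  [/\ P 0,
      forall a b, P a -> P b -> P (a + b),
      forall a b, P b -> P (a * b),
      ~ P 1 &
      forall a b, P (a * b) -> P a \/ P b].

(* P 0, ..., P l is a strictly increasing chain of primes containing J, that is,
   a chain of l + 1 primes of A/J. *)
Definition prime_chain J (l : nat) (P : nat -> A -> Prop) : Prop :=
  [/\ forall i, (i <= l)%N -> is_prime_ideal (P i),
      forall i, (i <= l)%N -> forall a, J a -> P i a &
      forall i, (i < l)%N ->
        (forall a, P i a -> P i.+1 a) /\ (exists2 a, P i.+1 a & ~ P i a)].

(* The Krull dimension of A/J is d. *)
Definition krull_dim_quotient J (d : nat) : Prop :=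
  (exists P : nat -> A -> Prop, prime_chain J d P) /\
  (forall l (P : nat -> A -> Prop), prime_chain J l P -> (l <= d)%N).

End Ideals.

Section Homological.
Variable A : comNzRingType.
Implicit Types (J : A -> Prop) (M N H : lmodType A).

(* For submodules B <= Z of M: H is isomorphic to Z/B. The map pi is only
   meaningful on Z, where it is linear and onto with kernel B. *)
Definition is_subquotient M (Z B : M -> Prop) H : Prop :=
  exists pi : M -> H,
    [/\ forall a x y, Z x -> Z y -> pi (a *: x + y) = a *: pi x + pi y,
        forall h, exists2 x, Z x & pi x = h &
        forall x, Z x -> (pi x = 0 <-> B x)].

(* The submodules U i of C i are meant to be stable under d, and H is
   the j-th cohomology of the complex (U, d), with U (-1) = 0. *)
Section Cohomology.
Variables (C : nat -> lmodType A) (d : forall i, C i -> C i.+1).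
Variable (U : forall i, C i -> Prop).

Definition cocycle j : C j -> Prop := fun x => U x /\ d x = 0.

Definition coboundary j : C j -> Prop :=
  match j with
  | 0%N => fun x => x = 0
  | k.+1 => fun x => exists2 y : C k, U y & d y = x
  end.

Definition is_cohomology j H : Prop :=
  is_subquotient (@cocycle j) (@coboundary j) H.
End Cohomology.

Definition injective_module (I : lmodType A) : Prop :=
  forall (M N : lmodType A) (f : {linear M -> N}) (g : {linear M -> I}),
    injective f -> exists h : {linear N -> I}, forall x, h (f x) = g x.

(* 0 -> M -> E 0 -> E 1 -> ... *)
Definition injective_resolution M (E : nat -> lmodType A)
    (eps : {linear M -> E 0%N}) (d : forall i, {linear E i -> E i.+1}) : Prop :=
  [/\ forall i, injective_module (E i),
      injective eps,
      forall x, d 0%N x = 0 <-> exists m, eps m = x &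
      forall i x, d i.+1 x = 0 <-> exists y, d i y = x].

(* Gamma_J(M) *)
Definition torsion J M : M -> Prop :=
  fun x => exists k, forall a, pow_ideal J k a -> a *: x = 0.

(* H is isomorphic to H^j_J(M), where H^j_J is the j-th right derived functor
   of Gamma_J. *)
Definition is_local_cohomology J (j : nat) M H : Prop :=
  exists E eps d, @injective_resolution M E eps d /\
    is_cohomology (C := E) (fun i => d i) (fun i => @torsion J (E i)) j H.

(* H is isomorphic to Ext^p_A(N, M), the p-th cohomology of Hom_A(N, E) for an
   injective resolution E of M; Hom_A(N, E i) is the submodule of linear maps
   in the module of all functions N -> E i. *)
Definition is_Ext (p : nat) N M H : Prop :=
  exists E eps d, @injective_resolution M E eps d /\
    is_cohomology (C := fun i => (N -> E i) : lmodType A)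
      (fun i f => d i \o f) (fun i f => linear f) p H.

(* N is isomorphic to A/J. *)
Definition is_quotient_ring_module J N : Prop :=
  is_subquotient (M := A^o) (fun _ => True) J N.

End Homological.

Section Lyubeznik.
Variables (K : fieldType) (n : nat).
Local Notation R := {mpoly K[n]}.
Implicit Types (J : R -> Prop) (M : lmodType R).

Definition max_ideal : R -> Prop := span_ideal [seq 'X_i | i : 'I_n].

(* dim_K M = l, with K acting through the constant polynomials *)
Definition has_dim M (l : nat) : Prop :=
  exists phi : M -> 'rV[K]_l,
    bijective phi /\
    forall (c : K) x y, phi (c%:MP *: x + y) = c *: phi x + phi y.

(* mu_p(m, M) = dim_K Ext^p_R(R/m, M); since m is maximal with residue field K,
   Ext^p_R(R/m, M) is unchanged by localization at m. *)
Definition bass_number (p : nat) M (l : nat) : Prop :=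
  exists N X : lmodType R,
    [/\ is_quotient_ring_module max_ideal N, is_Ext p N M X & has_dim X l].

(* lambda_{p,i}(R/J) = l; used for i <= n *)
Definition lyubeznik_number J (p i l : nat) : Prop :=
  exists2 H : lmodType R,
    is_local_cohomology J (n - i)%N (R^o : lmodType R) H & bass_number p H l.

Definition trivial_lyubeznik_table J : Prop :=
  exists d : nat,
    [/\ krull_dim_quotient J d,
        lyubeznik_number J d d 1 &
        forall p i, (p <= i)%N -> (i <= d)%N -> (p, i) <> (d, d) ->
          lyubeznik_number J p i 0].

Definition cover_ideal (e : rel 'I_n) : R -> Prop :=
  fun f => forall i j, e i j -> span_ideal [:: 'X_i; 'X_j] f.

End Lyubeznik.

Arguments cover_ideal K {n} e.

(* Main.v *)
(* Let J be the cover ideal.  For every R-module M the functions on monomials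
   with values in M form an injective module, Hom_K(R, M), and the Koszul complex
   of the operators f |-> X_l f - f(X_l .) on it is an injective resolution E(M)
   of M.  The part of E(M) killed by all variables is the Koszul complex of M, so
   Ext(K, M) is Koszul cohomology.

   Let T be the J-torsion of E(R), let x be the dominating vertex and y any
   other vertex.  Both x on T and y on ker(x | T) are onto, and ker(x, y | T) =
   ker(x, y | E(R)) because J is contained in (x, y); the latter complex has
   cohomology R/(x, y), in degree 2 only.  On ker(x | T) torsion for J is
   torsion for the product of the variables other than x, which acts onto on
   ker(x | E(R)), a complex exact from degree 2 on; hence H^q(ker(x | T)) = 0 for
   q >= 3.  Also H^0(T) = H^1(T) = 0, because J contains two coprime elements.
   The long exact sequences of multiplication by x and by y now show that x is
   bijective on H^q_J(R) for q >= 3, which kills its Bass numbers, and that on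
   H = H^2_J(R) the variable x is onto, y is onto on ker x, and ker(x, y) is
   R/(x, y).  So the Koszul cohomology of H is that of the remaining n - 2
   variables on R/(x, y): it is K in degree n - 2 and 0 elsewhere. *)

From HB Require Import structures.
Require Import Defs.
From mathcomp Require Import all_boot all_order all_algebra.
From mathcomp Require Import boolp classical_sets functions.
From mathcomp Require Import ssrcomplements mpoly zify.

Set Implicit Arguments.
Unset Strict Implicit.
Unset Printing Implicit Defensive.

Import GRing.Theory.
Local Open Scope ring_scope.

(** * Cofree modules *)

Section MonomialExtension.
Variables (K : fieldType) (n : nat).
Local Notation R := {mpoly K[n]}.
Variable M : lmodType R.
Implicit Types (g : 'X_{1..n} -> M) (r s : R).

(** The [K]-linear extension of [g] from the monomials to [R], with [K] acting on [M] through
    constant polynomials. *)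
Definition mono_ext g r : M := \sum_(b <- msupp r) (r@_b)%:MP *: g b.

(** A bound on the degree gives several polynomials one common index set, so additivity can be
    checked termwise. *)
Lemma mono_extE g r k : (msize r <= k)%N ->
  mono_ext g r = \sum_(b : 'X_{1..n < k}) (r@_b)%:MP *: g b.
Proof.
move=> le_rk; rewrite /mono_ext (big_mksub 'X_{1..n < k}) ?msupp_uniq //=; last first.
  by move=> x /msize_mdeg_lt /leq_trans; apply.
rewrite big_rmcond //= => j /memN_msupp_eq0 ->.
by rewrite mpolyC0 scale0r.
Qed.

Lemma mono_extD g r s : mono_ext g (r + s) = mono_ext g r + mono_ext g s.
Proof.
pose k := maxn (msize (r + s)) (maxn (msize r) (msize s)).
rewrite !(@mono_extE g _ k) /k ?leq_max ?leqnn ?orbT // -big_split /=.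
by apply: eq_bigr => b _; rewrite mcoeffD mpolyCD scalerDl.
Qed.

Lemma mono_extZ g c r : mono_ext g (c *: r) = c%:MP *: mono_ext g r.
Proof.
pose k := maxn (msize (c *: r)) (msize r).
rewrite !(@mono_extE g _ k) /k ?leq_max ?leqnn ?orbT // scaler_sumr.
by apply: eq_bigr => b _; rewrite mcoeffZ mpolyCM scalerA.
Qed.

Lemma mono_extX g b : mono_ext g 'X_[b] = g b.
Proof. by rewrite /mono_ext msuppX big_seq1 mcoeffX eqxx mpolyC1 scale1r. Qed.

Lemma mono_ext0r g : mono_ext g 0 = 0.
Proof. by rewrite /mono_ext msupp0 big_nil. Qed.

Lemma mono_ext_linear a g h r :
  mono_ext (fun b => a *: g b + h b) r = a *: mono_ext g r + mono_ext h r.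
Proof.
rewrite /mono_ext scaler_sumr -big_split /=; apply: eq_bigr => b _.
by rewrite scalerDr !scalerA mulrC.
Qed.

Lemma eq_mono_ext g h r : g =1 h -> mono_ext g r = mono_ext h r.
Proof. by move=> gh; apply: eq_bigr => b _; rewrite gh. Qed.

End MonomialExtension.

(* [cofree M] is Hom_K(R, M), a homomorphism being recorded by its values on
   the monomials. *)
Definition cofree (K : fieldType) (n : nat) (M : lmodType {mpoly K[n]}) : Type :=
  'X_{1..n} -> M.

Section Cofree.
Variables (K : fieldType) (n : nat).
Local Notation R := {mpoly K[n]}.
Variable M : lmodType R.
Implicit Types (f g : cofree M) (r s : R).

HB.instance Definition _ := GRing.Zmodule.copy (cofree M) ('X_{1..n} -> M).

(** The action [(r f)(s) = f(r s)] on [Hom_K(R, M)], as opposed to the action on values. *)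
Definition shift r f : cofree M := fun a => mono_ext (fun b => f (a + b)%MM) r.

Lemma shiftD r s f a : shift (r + s) f a = shift r f a + shift s f a.
Proof. exact: mono_extD. Qed.

Fact shiftDl f : {morph shift^~ f : r s / r + s}.
Proof. by move=> r s; apply/funext => a; exact: shiftD. Qed.

Fact shiftDr r : {morph shift r : f g / f + g}.
Proof.
move=> f g; apply/funext => a; rewrite /shift /=.
rewrite -[X in _ = X + _]scale1r -mono_ext_linear.
by apply: eq_mono_ext => b; rewrite scale1r.
Qed.

Lemma shiftZ c r f a : shift (c *: r) f a = c%:MP *: shift r f a.
Proof. by rewrite /shift mono_extZ. Qed.

Lemma shiftX b f a : shift 'X_[b] f a = f (a + b)%MM.
Proof. by rewrite /shift mono_extX. Qed.

Fact shift1 : left_id 1 shift.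
Proof. by move=> f; apply/funext => a; rewrite -mpolyX0 shiftX addm0. Qed.

Fact shiftA r s f : shift r (shift s f) = shift (r * s) f.
Proof.
apply/funext => a.
elim/mpolyind: r => [|c b r _ _ IHr]; first by rewrite mul0r /shift !mono_ext0r.
rewrite mulrDl !shiftD -scalerAl !shiftZ IHr; congr (_ *: _ + _).
rewrite shiftX {IHr}.
elim/mpolyind: s => [|d e s _ _ IHs]; first by rewrite mulr0 /shift !mono_ext0r.
rewrite mulrDr -scalerAr !shiftD !shiftZ IHs; congr (_ *: _ + _).
by rewrite -mpolyXD !shiftX addmA.
Qed.

HB.instance Definition _ := GRing.Zmodule_isLmodule.Build R (cofree M)
  shiftA shift1 shiftDr shiftDl.

Lemma cofreeD f g a : (f + g) a = f a + g a. Proof. by []. Qed.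
Lemma cofreeN f a : (- f) a = - f a. Proof. by []. Qed.
Lemma cofreeZE r f a : (r *: f) a = mono_ext (fun b => f (a + b)%MM) r.
Proof. by []. Qed.
Lemma cofreeZX b f a : ('X_[b] *: f) a = f (a + b)%MM.
Proof. exact: shiftX. Qed.
Lemma cofreeZC c f a : (c%:MP *: f) a = c%:MP *: f a.
Proof. by have := shiftZ c 1 f a; rewrite shift1 => <-; rewrite -mul_mpolyC mulr1. Qed.

End Cofree.

(** * Preradicals, complexes and cones *)

Section LinearFunctions.
Variables (A : comNzRingType) (U V : lmodType A) (f : U -> V).
Hypothesis lin_f : linear f.

Definition to_linear : {linear U -> V} :=
  HB.pack f (GRing.isLinear.Build A U V _ f lin_f).

Lemma lin0 : f 0 = 0. Proof. exact: (raddf0 to_linear). Qed.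
Lemma linD x y : f (x + y) = f x + f y. Proof. exact: (raddfD to_linear). Qed.
Lemma linN x : f (- x) = - f x. Proof. exact: (raddfN to_linear). Qed.
Lemma linB x y : f (x - y) = f x - f y. Proof. exact: (raddfB to_linear). Qed.
Lemma linZ a x : f (a *: x) = a *: f x. Proof. exact: (linearZ_LR to_linear). Qed.
End LinearFunctions.

(** A subfunctor of the identity on modules. Torsion and annihilators are both of this kind, and
    functoriality alone lets them restrict a complex and split over products. *)
Record preradical (A : comNzRingType) := Preradical {
  prd :> forall M : lmodType A, M -> Prop;
  prd0 : forall M : lmodType A, prd (0 : M);
  prd_lin : forall (M : lmodType A) a (x y : M), prd x -> prd y -> prd (a *: x + y);
  prd_map : forall (M N : lmodType A) (f : M -> N) x,
    linear f -> prd x -> prd (f x) }.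

Arguments prd {A} _ {M} _.
Arguments prd0 {A} _ M.

Section Preradicals.
Variable A : comNzRingType.
Implicit Types (U : preradical A) (M N : lmodType A).

Lemma prdD U M (x y : M) : prd U x -> prd U y -> prd U (x + y).
Proof. by move=> Ux Uy; rewrite -[x]scale1r; apply: prd_lin. Qed.

Lemma prdZ U M a (x : M) : prd U x -> prd U (a *: x).
Proof. by move=> Ux; rewrite -[_ *: x]addr0; apply: prd_lin => //; apply: prd0. Qed.

Lemma prdN U M (x : M) : prd U x -> prd U (- x).
Proof. by rewrite -scaleN1r; apply: prdZ. Qed.

Lemma prdB U M (x y : M) : prd U x -> prd U y -> prd U (x - y).
Proof. by move=> Ux Uy; apply: prdD => //; apply: prdN. Qed.

Lemma prd_pair U M N (x : (M * N)%type) : prd U x <-> prd U x.1 /\ prd U x.2.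
Proof.
split=> [Ux | [Ux1 Ux2]].
  by split; [apply: (prd_map (f := fst)) Ux | apply: (prd_map (f := snd)) Ux].
have -> : x = (x.1, 0) + (0, x.2).
  by case: x {Ux1 Ux2} => x1 x2; congr pair; rewrite /= ?addr0 ?add0r.
apply: prdD.
- apply: (prd_map (f := fun u : M => (u, 0 : N)) _ Ux1) => a u v.
  by congr pair; rewrite /= scaler0 addr0.
- apply: (prd_map (f := fun u : N => (0 : M, u)) _ Ux2) => a u v.
  by congr pair; rewrite /= scaler0 addr0.
Qed.

Definition prd_ann (S : A -> Prop) : preradical A.
Proof.
exists (fun M (x : M) => forall s, S s -> s *: x = 0).
- by move=> M s _; rewrite scaler0.
- move=> M a x y hx hy s Ss.
  by rewrite scalerDr scalerA mulrC -scalerA hx // hy // scaler0 addr0.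
- by move=> M N f x lf hx s Ss; rewrite -linZ // hx // lin0.
Defined.

Definition prd_meet U1 U2 : preradical A.
Proof.
exists (fun M (x : M) => prd U1 x /\ prd U2 x).
- by move=> M; split; apply: prd0.
- by move=> M a x y [? ?] [? ?]; split; apply: prd_lin.
- by move=> M N f x lf [? ?]; split; apply: prd_map.
Defined.

Lemma pow_ideal0 J k : pow_ideal J k (0 : A).
Proof. by case: k => // k; exists [::] => //; rewrite big_nil. Qed.

Lemma pow_idealD J k (a b : A) : pow_ideal J k a -> pow_ideal J k b -> pow_ideal J k (a + b).
Proof.
case: k => // k [s1 h1 ->] [s2 h2 ->]; exists (s1 ++ s2); last by rewrite big_cat.
by move=> u; rewrite mem_cat => /orP [/h1 | /h2].
Qed.

Lemma pow_idealMl J k (a b : A) : pow_ideal J k b -> pow_ideal J k (a * b).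
Proof.
elim: k b => // k IH b [s hs ->]; exists [seq (u.1, a * u.2) | u <- s].
  by move=> _ /mapP [u /hs [? ?] ->]; split=> //; apply: IH.
by rewrite big_map mulr_sumr; apply: eq_bigr => u _ /=; rewrite mulrCA.
Qed.

Lemma pow_idealS J k (a : A) : pow_ideal J k.+1 a -> pow_ideal J k a.
Proof.
case=> s hs ->; elim: s hs => [|u s IH] hs; first by rewrite big_nil; apply: pow_ideal0.
rewrite big_cons; apply: pow_idealD; last by apply: IH => v vs; apply: hs; rewrite inE vs orbT.
by apply: pow_idealMl; have [] := hs u (mem_head _ _).
Qed.

Lemma pow_ideal_le J k m (a : A) : (k <= m)%N -> pow_ideal J m a -> pow_ideal J k a.
Proof.
by move/subnK <-; elim: (m - k)%N => // i IH /pow_idealS.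
Qed.

Definition prd_tor (J : A -> Prop) : preradical A.
Proof.
exists (fun M (x : M) => torsion J x).
- by move=> M; exists 0%N => a _; rewrite scaler0.
- move=> M a x y [k hx] [m hy]; exists (maxn k m) => b Jb.
  rewrite scalerDr scalerA mulrC -scalerA hx ?hy ?scaler0 ?addr0 //.
  + exact: pow_ideal_le (leq_maxr _ _) Jb.
  + exact: pow_ideal_le (leq_maxl _ _) Jb.
- by move=> M N f x lf [k hx]; exists k => a Ja; rewrite -linZ // hx // lin0.
Defined.

End Preradicals.

(** * Complexes with a second action, and their mapping cones *)

Section Complexes.
Variables (K : fieldType) (n : nat).
Local Notation R := {mpoly K[n]}.

Definition cochain (F : lmodType R) (hi : nat -> lmodType R) (p : nat) : lmodType R :=
  if p is k.+1 then hi k else F.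

(* [F] is kept apart from [hi] so that degree 0 of any cone is convertible to
   [F]; [act] is a second action of R, in practice the action on values. *)
Record bicomplex (F : lmodType R) := Bicomplex {
  hi : nat -> lmodType R;
  dif : forall p, cochain F hi p -> cochain F hi p.+1;
  act : forall p, R -> cochain F hi p -> cochain F hi p;
  dif_lin : forall p, linear (@dif p);
  act_lin : forall p r, linear (@act p r);
  actDl : forall p r s x, @act p (r + s) x = act r x + act s x;
  actM : forall p r s x, @act p (r * s) x = act r (act s x);
  actC : forall p c x, @act p c%:MP x = c%:MP *: x;
  dif_act : forall p r x, @dif p (act r x) = act r (dif x);
  dif_dif : forall p x, dif (@dif p x) = 0 }.

Arguments dif {F} _ {p} _.
Arguments act {F} _ {p} _ _.

Definition ob F (C : bicomplex F) p := cochain F (hi C) p.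

Section Cone.
Variables (F : lmodType R) (C : bicomplex F) (l : 'I_n).

(** On [Hom_K(R, M)] this is [f |-> X_l f - f(X_l .)], which measures the failure of
    [X_l]-linearity. *)
Definition defect p (x : ob C p) : ob C p := act C 'X_l x - 'X_l *: x.

Lemma defect_lin p : linear (@defect p).
Proof.
move=> a x y; rewrite /defect act_lin scalerDr scalerBr !scalerA mulrC opprD.
by rewrite addrACA.
Qed.

Lemma dif_defect p (x : ob C p) : dif C (defect x) = defect (dif C x).
Proof. by rewrite /defect (linB (@dif_lin _ _ _)) dif_act (linZ (@dif_lin _ _ _)). Qed.

Lemma act_defect p r (x : ob C p) : act C r (defect x) = defect (act C r x).
Proof.
rewrite /defect (linB (@act_lin _ _ _ _)) (linZ (@act_lin _ _ _ _)).
by rewrite -!actM mulrC.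
Qed.

Definition cone_hi k : lmodType R := (ob C k.+1 * ob C k)%type.

(** The mapping cone of [defect l], shifted so that degree [p + 1] pairs degrees [p + 1] and [p] of
    [C]. The minus sign makes it square to zero. *)
Definition cone_dif p : cochain F cone_hi p -> cochain F cone_hi p.+1 :=
  match p with
  | 0 => fun x => (dif C (p := 0) x, defect (p := 0) x)
  | k.+1 => fun x => (dif C x.1, defect x.1 - dif C x.2)
  end.

Definition cone_act p r : cochain F cone_hi p -> cochain F cone_hi p :=
  match p with
  | 0 => act C (p := 0) r
  | k.+1 => fun x => (act C r x.1, act C r x.2)
  end.

Definition cone : bicomplex F.
Proof.
exists cone_hi cone_dif cone_act.
- case=> [|p] a x y /=; congr pair; rewrite ?dif_lin ?defect_lin //=.
  by rewrite scalerBr opprD addrACA.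
- by case=> [|p] r a x y /=; rewrite ?act_lin.
- by case=> [|p] r s x /=; rewrite ?actDl.
- by case=> [|p] r s x /=; rewrite ?actM.
- case=> [|p] c x /=; rewrite ?actC //.
- case=> [|p] r x /=; rewrite ?dif_act ?act_defect //.
  by rewrite (linB (@act_lin _ _ _ _)) act_defect.
- case=> [|p] x /=; congr pair; rewrite ?dif_dif ?dif_defect ?subrr //.
  by rewrite (linB (@dif_lin _ _ _)) dif_dif subr0 dif_defect subrr.
Defined.

End Cone.
End Complexes.

(** * Exactness of cones *)

Arguments dif {K n F} _ {p} _.
Arguments act {K n F} _ {p} _ _.

Section Exactness.
Variables (K : fieldType) (n : nat).
Local Notation R := {mpoly K[n]}.
Implicit Types (F : lmodType R) (U : preradical R).

Definition is_bnd F (C : bicomplex F) U p (y : ob C p) : Prop :=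
  coboundary (C := ob C) (fun i => @dif _ _ _ C i) (fun i => @prd _ U (ob C i)) y.

(** In degree [0] the only boundary is [0], so exactness there says that [U] contains no nonzero
    cocycle. *)
Definition exact_at F (C : bicomplex F) U p : Prop :=
  forall y : ob C p, prd U y -> dif C y = 0 -> is_bnd U y.

Section Boundaries.
Variables (F : lmodType R) (C : bicomplex F) (U : preradical R).

Lemma bnd0 p : is_bnd U (0 : ob C p).
Proof.
case: p => [|p] //=; exists 0; first exact: prd0.
by rewrite (lin0 (@dif_lin _ _ _ _ _)).
Qed.

Lemma bnd_lin p a (x y : ob C p) : is_bnd U x -> is_bnd U y -> is_bnd U (a *: x + y).
Proof.
case: p x y => [|p] x y /=; first by move=> -> ->; rewrite scaler0 addr0.
move=> [u Uu <-] [v Uv <-]; exists (a *: u + v); first exact: prd_lin.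
by rewrite dif_lin.
Qed.

Lemma bndD p (x y : ob C p) : is_bnd U x -> is_bnd U y -> is_bnd U (x + y).
Proof. by move=> bx by_; rewrite -[x]scale1r; apply: bnd_lin. Qed.

Lemma bndZ p a (x : ob C p) : is_bnd U x -> is_bnd U (a *: x).
Proof. by move=> bx; rewrite -[_ *: x]addr0; apply: bnd_lin => //; apply: bnd0. Qed.

Lemma bndN p (x : ob C p) : is_bnd U x -> is_bnd U (- x).
Proof. by rewrite -scaleN1r; apply: bndZ. Qed.

Lemma bndB p (x y : ob C p) : is_bnd U x -> is_bnd U y -> is_bnd U (x - y).
Proof. by move=> bx /bndN; apply: bndD. Qed.

Lemma bnd_act p r (x : ob C p) : is_bnd U x -> is_bnd U (act C r x).
Proof.
case: p x => [|p] x /=; first by move=> ->; rewrite (lin0 (@act_lin _ _ _ _ _ _)).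
move=> [u Uu <-]; exists (act C r u); last by rewrite dif_act.
exact: prd_map (@act_lin _ _ _ _ _ _) Uu.
Qed.

Lemma bnd_prd p (x : ob C p) : is_bnd U x -> prd U x.
Proof.
case: p x => [|p] x /=; first by move=> ->; apply: prd0.
by case=> u Uu <-; apply: prd_map (@dif_lin _ _ _ _ _) Uu.
Qed.

Lemma bnd_dif p (x : ob C p) : is_bnd U x -> dif C x = 0.
Proof.
case: p x => [|p] x /=; first by move=> ->; rewrite (lin0 (@dif_lin _ _ _ _ _)).
by case=> u Uu <-; apply: dif_dif.
Qed.

Lemma actBl p r s (x : ob C p) : act C (r - s) x = act C r x - act C s x.
Proof.
by apply/eqP; rewrite eq_sym subr_eq -actDl subrK.
Qed.

Lemma prd_defect l p (x : ob C p) : prd U x -> prd U (defect l x).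
Proof. exact: prd_map (@defect_lin _ _ _ _ _ _). Qed.

Lemma prd_act r p (x : ob C p) : prd U x -> prd U (act C r x).
Proof. exact: prd_map (@act_lin _ _ _ _ _ _). Qed.

Lemma prd_dif p (x : ob C p) : prd U x -> prd U (dif C x).
Proof. exact: prd_map (@dif_lin _ _ _ _ _). Qed.

(** The [r] for which the two actions agree on the class of [z] include the constants and are closed
    under sums and products. *)
Lemma bnd_act_scale p (z : ob C p) :
  (forall l, is_bnd U (act C 'X_l z - 'X_l *: z)) ->
  forall r, is_bnd U (act C r z - r *: z).
Proof.
move=> goodX; pose good r := is_bnd U (act C r z - r *: z).
have goodM a b : good a -> good b -> good (a * b).
  move=> ga gb; rewrite /good.
  have -> : act C (a * b) z - (a * b) *: z
      = act C a (act C b z - b *: z) + b *: (act C a z - a *: z).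
    rewrite actM (linB (@act_lin _ _ _ _ _ _)) (linZ (@act_lin _ _ _ _ _ _)).
    by rewrite scalerBr scalerA addrA subrK [b * a]mulrC.
  by apply: bndD; [apply: bnd_act | apply: bndZ].
have goodC (c : K) : good c%:MP by rewrite /good actC subrr; apply: bnd0.
have goodD a b : good a -> good b -> good (a + b).
  by move=> ga gb; rewrite /good actDl scalerDl opprD addrACA; apply: bndD.
elim/mpolyind => [|c b r _ _ gr]; first exact: (goodC 0).
apply: goodD => //; rewrite -mul_mpolyC; apply: (goodM) => //.
have good1 : good 1 by rewrite -mpolyC1; apply: goodC.
rewrite mpolyXE_id; apply: (big_ind good) => // i _.
elim: (b i) => [|k IHk]; first by rewrite expr0.
by rewrite exprS; apply: (goodM) => //; apply: goodX.
Qed.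

End Boundaries.

(** * Cohomology of a cone in terms of its base *)

Section ConeCohomology.
Variables (F : lmodType R) (C : bicomplex F) (U : preradical R) (l : 'I_n).

Lemma cone_bndP p (x : ob (cone C l) p.+1) :
  is_bnd U x <->
  exists c : ob C p, [/\ prd U c, dif C c = x.1 & is_bnd U (x.2 - defect l c)].
Proof.
case: p x => [|p] [a b] /=; split.
- by case=> c Uc [<- <-]; exists c; split=> //; rewrite subrr.
- by case=> c [Uc <- /subr0_eq ->]; exists c.
- case=> [[c e]] /prd_pair [/= Uc Ue] [<- <-]; exists c; split=> //.
  exists (- e); first exact: prdN.
  by rewrite (linN (@dif_lin _ _ _ _ _)) addrAC subrr add0r.
- case=> c [Uc <- [e Ue de]]; exists (c, - e).
    by apply/prd_pair; split=> //; apply: prdN.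
  congr pair => //=.
  by rewrite (linN (@dif_lin _ _ _ _ _)) opprK de addrC subrK.
Qed.

(** A piece of the long exact sequence of the cone: the defect has to be injective on cohomology in
    degree [p + 1], and the base has to be exact in degree [p]. *)
Lemma cone_exact_succ p :
  (forall a : ob C p.+1, prd U a -> dif C a = 0 -> is_bnd U (defect l a) -> is_bnd U a) ->
  exact_at C U p -> exact_at (cone C l) U p.+1.
Proof.
move=> exS ex0 [a b] /prd_pair [/= Ua Ub] [da /subr0_eq dab].
have [|c Uc dc] := exS a Ua da; first by rewrite dab; exists b.
apply/cone_bndP; exists c; split=> //=; apply: ex0.
  by apply: prdB => //; apply: prd_defect.
by rewrite (linB (@dif_lin _ _ _ _ _)) dif_defect dc dab subrr.
Qed.

Lemma cone_exact p : exact_at C U p -> exact_at C U p.+1 -> exact_at (cone C l) U p.+1.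
Proof. by move=> ex0 ex1; apply: cone_exact_succ => // a Ua da _; apply: ex1. Qed.

Lemma cone_exact0 :
  (forall a : ob C 0, prd U a -> dif C a = 0 -> defect l a = 0 -> a = 0) ->
  exact_at (cone C l) U 0.
Proof. by move=> h y Uy [dy ey]; apply: h. Qed.

(** The base need not be exact in degree [0]; its contribution to degree [1] of the cone is the
    cokernel of the defect on degree-[0] cocycles. *)
Lemma cone_exact1 :
  (forall y : ob C 0, prd U y -> dif C y = 0 ->
    exists w : ob C 0, [/\ prd U w, dif C w = 0 & defect l w = y]) ->
  exact_at C U 1 -> exact_at (cone C l) U 1.
Proof.
move=> surj ex1 [a b] /prd_pair [/= Ua Ub] [da /subr0_eq dab].
have [c Uc dc] := ex1 a Ua da.
(* Adding the cocycle [w] to [c] adjusts the second component to [b] and leaves [dif C c]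
   unchanged. *)
have [||w [Uw dw ew]] := surj (b - defect l c).
- by apply: prdB => //; apply: (@prd_defect _ C).
- by rewrite (linB (@dif_lin _ _ _ C _)) dif_defect dc dab subrr.
exists (c + w : ob C 0); first exact: prdD.
congr pair; rewrite /=.
  by rewrite (linD (@dif_lin _ _ _ C _)) dw addr0.
by rewrite (linD (@defect_lin _ _ _ C l 0)) ew addrC subrK.
Qed.

(** The [U]-part of [D] has cohomology [R/I], concentrated in degree [t] and generated by the class
    of [z] under [act]. *)
Definition cyclic_cohomology G (D : bicomplex G) t (z : ob D t) (I : R -> Prop) : Prop :=
  [/\ forall q, q <> t -> exact_at D U q,
      prd U z, dif D z = 0,
      forall y : ob D t, prd U y -> dif D y = 0 -> exists r, is_bnd U (y - act D r z) &
      forall r, is_bnd U (act D r z) <-> I r].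

(** As the scalar ['X_l] kills [U], the defect is multiplication by ['X_l] on [R/I]. It is injective
    there, so only its cokernel [R/(I + X_l R)] survives, one degree higher. *)
Lemma cyclic_cone t (z : ob C t) (I : R -> Prop) :
  (forall p (x : ob C p), prd U x -> 'X_l *: x = 0) ->
  (forall r, I ('X_l * r) -> I r) ->
  cyclic_cohomology z I ->
  cyclic_cohomology ((0, z) : ob (cone C l) t.+1)
    (fun r => exists s, I (r - 'X_l * s)).
Proof.
move=> kill inj [exC Uz dz genz annz].
have defE p (x : ob C p) : prd U x -> defect l x = act C 'X_l x.
  by move=> Ux; rewrite /defect kill // subr0.
have injl a : prd U a -> dif C a = 0 -> is_bnd U (defect l a) -> is_bnd U (a : ob C t).
  move=> Ua da ba; have [r br] := genz _ Ua da.
  rewrite -[a](subrK (act C r z)); apply: bndD => //.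
  apply/annz/inj/annz; rewrite actM.
  have -> : act C 'X_l (act C r z) = defect l a - act C 'X_l (a - act C r z).
    by rewrite defE // (linB (@act_lin _ _ _ _ _ _)) opprB addrC subrK.
  by apply: bndB => //; apply: bnd_act.
split.
- case=> [_|q neq_qt].
    apply: cone_exact0 => a Ua da ea.
    have [t0|neq_t0] := eqVneq t 0%N; last by apply: (exC 0%N) => //; apply/eqP; rewrite eq_sym.
    by move: t0 z Uz dz genz annz injl exC => -> {}z _ _ _ _ injl _; apply: injl.
  apply: cone_exact_succ; last by apply: exC => eq_qt; apply: neq_qt; rewrite eq_qt.
  have [e|ne] := eqVneq q.+1 t; last by move=> a Ua da _; apply: exC => //; apply/eqP.
  by move: t e z Uz dz genz annz injl exC neq_qt => _ <-.
- by apply/prd_pair; split=> //; apply: prd0.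
- case: t z Uz dz {genz annz injl exC} => [|t] z Uz dz /=; congr pair => /=;
    by rewrite ?(lin0 (@dif_lin _ _ _ _ _)) ?(lin0 (@defect_lin _ _ _ _ _ _)) ?dz ?subr0.
- move=> [a b] /prd_pair [/= Ua Ub] [da /subr0_eq dab].
  have [|c Uc dc] := exC t.+1 _ a Ua da; first by move/eqP; rewrite gtn_eqF.
  have [||r br] := genz (b - defect l c).
  + by apply: prdB => //; apply: prd_defect.
  + by rewrite (linB (@dif_lin _ _ _ _ _)) dif_defect dc dab subrr.
  exists r; apply/cone_bndP; exists c; split=> //=.
    by rewrite (lin0 (@act_lin _ _ _ _ _ _)) subr0.
  by rewrite addrAC.
- move=> r; split.
    move=> /cone_bndP [c [Uc /=]]; rewrite (lin0 (@act_lin _ _ _ _ _ _)) => dc.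
    rewrite defE // => bc; have [s bs] := genz _ Uc dc.
    exists s; apply/annz.
    have -> : act C (r - 'X_l * s) z
        = (act C r z - act C 'X_l c) + act C 'X_l (c - act C s z).
      by rewrite (linB (@act_lin _ _ _ _ _ _)) addrA subrK -actM actBl.
    by apply: bndD => //; apply: bnd_act.
  move=> [s /annz bs]; apply/cone_bndP; exists (act C s z); split=> /=.
  + exact: prd_act.
  + by rewrite dif_act dz !(lin0 (@act_lin _ _ _ _ _ _)).
  rewrite defE; last exact: prd_act.
  by rewrite -actM -actBl.
Qed.

End ConeCohomology.
End Exactness.

(** * Koszul resolutions *)

Section Koszul.
Variables (K : fieldType) (n : nat).
Local Notation R := {mpoly K[n]}.
Variable M : lmodType R.

Definition zero_module : lmodType R := 'rV[R]_0.

Lemma zero_moduleE (x : zero_module) : x = 0.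
Proof. exact: thinmx0. Qed.

Definition value_act (r : R) (f : cofree M) : cofree M := fun a => r *: f a.

Lemma value_act_lin r : linear (value_act r).
Proof.
move=> a f g; apply/funext => b; rewrite /value_act cofreeD scalerDr cofreeD.
congr (_ + _); rewrite !cofreeZE /mono_ext scaler_sumr; apply: eq_bigr => c _.
by rewrite !scalerA mulrC.
Qed.

Definition koszul0_act p : R -> cochain (cofree M) (fun=> zero_module) p ->
    cochain (cofree M) (fun=> zero_module) p :=
  if p is _.+1 then fun r x => 0 else value_act.

Definition koszul0 : bicomplex (cofree M).
Proof.
exists (fun=> zero_module) (fun p x => 0) koszul0_act.
- by move=> p a x y; rewrite scaler0 addr0.
- by case=> [|p] r; [apply: value_act_lin | move=> a x y /=; rewrite scaler0 addr0].
- case=> [|p] r s x /=; rewrite ?addr0 //.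
  by apply/funext => b; rewrite /value_act scalerDl.
- case=> [|p] r s x //=.
  by apply/funext => b; rewrite /value_act scalerA.
- case=> [|p] c x /=; last by rewrite (zero_moduleE x) scaler0.
  by apply/funext => b; rewrite cofreeZC.
- by move=> [|p] r x.
- by [].
Defined.

(* The head of [s] is the outermost cone. *)
Definition koszul (s : seq 'I_n) : bicomplex (cofree M) :=
  foldr (fun l C => cone C l) koszul0 s.

Lemma koszul_act0 s r (f : cofree M) : act (koszul s) (p := 0) r f = value_act r f.
Proof. by elim: s. Qed.

Lemma koszul_defect0 s l (f : cofree M) a :
  (defect l (f : ob (koszul s) 0) : cofree M) a = 'X_l *: f a - f (a + U_(l))%MM.
Proof. by rewrite /defect koszul_act0 cofreeD cofreeN cofreeZX. Qed.

Lemma koszul_dif0 s (f : cofree M) :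
  dif (koszul s) (p := 0) f = 0 <->
  {in s, forall l a, f (a + U_(l))%MM = 'X_l *: f a}.
Proof.
elim: s => [|l s IHs]; first by split.
split=> [[/IHs fs fl] k|fs].
  rewrite inE => /predU1P [-> a|]; last exact: fs.
  move/(congr1 (fun g : cofree M => g a)): fl.
  by rewrite koszul_defect0 => /subr0_eq.
congr pair; first by apply/IHs => k ks; apply: fs; rewrite inE ks orbT.
apply/funext => a; rewrite [LHS]koszul_defect0.
by rewrite fs ?mem_head // subrr.
Qed.

(** Solves [defect l f = g] by recursion on the exponent of [l], with value [0] at exponent [0]. The
    other exponents are never touched. *)
Fixpoint solve_rec l (g : cofree M) (j : nat) (a : 'X_{1..n}) : M :=
  if j is i.+1 then
    'X_l *: solve_rec l g i (a - U_(l))%MM - g (a - U_(l))%MM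
  else 0.

Definition solve_defect l g : cofree M := fun a => solve_rec l g (a l) a.

Lemma solve_defectE l g a :
  solve_defect l g (a + U_(l))%MM = 'X_l *: solve_defect l g a - g a.
Proof. by rewrite /solve_defect mnmDE mnm1E eqxx addn1 /= addmK. Qed.

(** With [c = 'X_k] this preserves linearity in ['X_k]; with [c = 0] it preserves annihilation by
    ['X_k]. *)
Lemma solve_defect_eigen l k (c : R) g : k != l ->
  (forall a, g (a + U_(k))%MM = c *: g a) ->
  forall a, solve_defect l g (a + U_(k))%MM = c *: solve_defect l g a.
Proof.
move=> neq_kl gk a; rewrite /solve_defect mnmDE mnm1E (negbTE neq_kl) addn0.
have [j] := ubnP (a l); move eq_m: (a l) => m _ {j}.
elim: m a eq_m => [|j IHj] a al /=; first by rewrite scaler0.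
have -> : (a + U_(k) - U_(l) = a - U_(l) + U_(k))%MM.
  apply/mnmP => i; rewrite !(mnmDE, mnmBE) !mnm1E.
  case: eqP => [<-|]; first by rewrite eq_sym (negbTE neq_kl) !subn0.
  by rewrite !addn0.
rewrite IHj; last by rewrite mnmBE mnm1E eqxx al subn1.
by rewrite gk scalerBr !scalerA mulrC.
Qed.

Definition ann_vars (A : pred 'I_n) : preradical R :=
  prd_ann (fun r => exists2 l, A l & r = 'X_l).

Lemma ann_varsP A (f : cofree M) :
  prd (ann_vars A) f <-> forall l, A l -> forall a, f (a + U_(l))%MM = 0.
Proof.
split=> [h l Al a|h _ [l Al ->]].
  by rewrite -cofreeZX h //; exists l.
by apply/funext => a; rewrite cofreeZX h.
Qed.

Lemma koszul_solve s l A (g : ob (koszul s) 0) : l \notin s -> ~~ A l ->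
  prd (ann_vars A) g -> dif (koszul s) g = 0 ->
  exists w : ob (koszul s) 0,
    [/\ prd (ann_vars A) w, dif (koszul s) w = 0 & defect l w = g].
Proof.
move=> ls Al /ann_varsP gA /koszul_dif0 gs; exists (solve_defect l g); split.
- apply/ann_varsP => k Ak a; rewrite (@solve_defect_eigen l k 0) ?scale0r //.
    by apply: contraNneq Al => <-.
  by move=> b; rewrite scale0r gA.
- apply/koszul_dif0 => k ks a; apply: solve_defect_eigen; last exact: gs.
  by apply: contraNneq ls => <-.
- apply/funext => a; rewrite koszul_defect0 solve_defectE opprB.
  by rewrite addrC subrK.
Qed.

(** Each cone keeps positive degrees exact: degree [1] because [koszul_solve] makes the defect onto
    on degree-[0] cocycles, higher degrees by exactness of the base. *)
Lemma koszul_exact s A p : uniq s -> {in s, forall l, ~~ A l} -> (0 < p)%N ->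
  exact_at (koszul s) (ann_vars A) p.
Proof.
case: p => // p; elim: s p => [|l s IHs] p /=.
  move=> _ _ _ y _ _; exists (0 : ob koszul0 p); first exact: prd0.
  by rewrite (zero_moduleE y).
move=> /andP [ls us] sA _.
have {}IHs q : exact_at (koszul s) (ann_vars A) q.+1.
  by apply: IHs => // k ks; apply: sA; rewrite inE ks orbT.
case: p => [|p]; last exact: cone_exact.
apply: cone_exact1 => // g gA dg; apply: koszul_solve => //.
by apply: sA; rewrite mem_head.
Qed.

(** Every degree is a finite product of copies of [cofree M], and a preradical splits over
    products. *)
Lemma koszul_onto (U : preradical R) (x : R) s :
  (forall f : cofree M, prd U f -> exists2 g : cofree M, prd U g & x *: g = f) ->
  forall p (y : ob (koszul s) p), prd U y -> exists2 w, prd U w & x *: w = y.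
Proof.
move=> onto; elim: s => [|l s IHs] [|p] y //=.
- exact: onto.
- by exists 0; [exact: prd0 | rewrite (zero_moduleE y) scaler0].
- exact: (IHs 0%N).
case: y => a b /prd_pair [/IHs [u Uu xu] /IHs [v Uv xv]].
by exists (u, v); [apply/prd_pair | congr pair; rewrite ?xu ?xv].
Qed.

(** The embedding [m |-> (r |-> r m)] of [M] into [Hom_K(R, M)]. *)
Definition cofree_unit (m : M) : cofree M := fun a => 'X_[a] *: m.

Lemma mono_ext_scale (m : M) (r : R) : mono_ext (fun b => 'X_[b] *: m) r = r *: m.
Proof.
rewrite [in RHS](mpolyE r) /mono_ext scaler_suml; apply: eq_bigr => b _.
by rewrite scalerA mul_mpolyC.
Qed.

Lemma cofree_unit_lin : linear cofree_unit.
Proof.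
move=> r x y; apply/funext => a; rewrite cofreeD cofreeZE /cofree_unit scalerDr.
congr (_ + _); rewrite -[r *: x]mono_ext_scale /mono_ext scaler_sumr; apply: eq_bigr => b _.
by rewrite mpolyXD !scalerA mulrCA mulrA.
Qed.

Lemma cofree_unit_inj : injective cofree_unit.
Proof.
move=> x y /(congr1 (fun f : cofree M => f 0%MM)).
by rewrite /cofree_unit mpolyX0 !scale1r.
Qed.

Lemma cocycle0_value (s : seq 'I_n) (f : cofree M) : {in s, forall l a, f (a + U_(l))%MM = 'X_l *: f a} ->
  forall a (b : 'X_{1..n}), (forall l, l \notin s -> b l = 0%N) -> f (a + b)%MM = 'X_[b] *: f a.
Proof.
move=> fs a b; move: {2}(mdeg b) (erefl (mdeg b)) => d.
elim: d b => [|d IHd] b db bs.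
  by move/eqP: db; rewrite mdeg_eq0 => /eqP ->; rewrite mpolyX0 scale1r addm0.
have [l bl] : exists l, b l != 0%N.
  by apply/existsP; move: db; apply: contra_eqT; rewrite negb_exists => /forallP h;
     rewrite mdegE big1 // => i _; apply/eqP; move: (h i); rewrite negbK.
have ls : l \in s by apply: contraNT bl => /bs ->.
have eb : (b - U_(l) + U_(l) = b)%MM by rewrite submK // lep1mP.
have IHb : f (a + (b - U_(l)))%MM = 'X_[b - U_(l)] *: f a.
  apply: IHd => [|k ks]; last by rewrite mnmBE bs.
  by apply: succn_inj; rewrite -db -[in RHS]eb mdegD mdeg1 addn1.
by rewrite -{1}eb addmA fs // IHb scalerA -mpolyXD addmC eb.
Qed.

Lemma koszul_cocycle0 s (f : cofree M) : (forall l, l \in s) ->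
  dif (koszul s) (p := 0) f = 0 <-> exists m, cofree_unit m = f.
Proof.
move=> all_s; split=> [/koszul_dif0 fs|[m <-]].
  exists (f 0%MM); apply/funext => a.
  by rewrite /cofree_unit -(cocycle0_value fs) ?add0m // => l; rewrite all_s.
by apply/koszul_dif0 => l _ a; rewrite /cofree_unit scalerA -mpolyXD addmC.
Qed.

End Koszul.

(** * Injectivity *)

Section Injectives.
Variables (K : fieldType) (n : nat).
Local Notation R := {mpoly K[n]}.
Implicit Types (M N B : lmodType R).

Definition K_linear M N (f : M -> N) : Prop :=
  forall (c : K) x y, f (c%:MP *: x + y) = c%:MP *: f x + f y.

Section Extension.
Variables (A B M : lmodType R) (f : {linear A -> B}) (g : A -> M).
Hypotheses (inj_f : injective f) (Kg : K_linear g).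

(** Graphs of [K]-linear maps on subspaces of [B]; by linearity it is enough to test
    single-valuedness at [0]. *)
Let partial_map (G : set (B * M)) : Prop :=
  (forall (c : K) u v, G u -> G v -> G (c%:MP *: u.1 + v.1, c%:MP *: u.2 + v.2)) /\
  (forall m, G (0, m) -> m = 0).

Let graph : set (B * M) := fun u => exists a, u = (f a, g a).

Let graph_partial : partial_map graph.
Proof.
split=> [c _ _ [a ->] [b ->]|m [a [fa ->]]] /=.
  by exists (c%:MP *: a + b); rewrite linearP Kg.
have <- : 0 = a by apply: inj_f; rewrite linear0.
by have := Kg (-1) 0 0; rewrite scaler0 addr0 mpolyCN mpolyC1 scaleN1r addNr.
Qed.

Lemma K_linear_extension : exists2 h : B -> M, K_linear h & forall a, h (f a) = g a.
Proof.
(* Zorn is applied to sets whose union with [graph] is a partial map, so that the empty chain also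
   has an upper bound. *)
have [|A0 [[linA funA] maxA]] :=
  @Zorn_bigcup (B * M)%type [set G | partial_map (G `|` graph)%classic].
  move=> F FP totF /=.
  have two u v : (\bigcup_(X in F) X `|` graph)%classic u ->
      (\bigcup_(X in F) X `|` graph)%classic v ->
      exists2 G, partial_map G & [/\ G u, G v & (G `<=` \bigcup_(X in F) X `|` graph)%classic].
    have sub X : F X -> (X `|` graph `<=` \bigcup_(X in F) X `|` graph)%classic.
      by move=> FX w [Xw|?]; [left; exists X | right].
    move=> [[X FX Xu]|gu] [[Y FY Yv]|gv].
    - have [XY|YX] := totF _ _ FX FY.
      + exists (Y `|` graph)%classic; [exact: FP|split; [left; exact: XY|by left|exact: sub]].
      + exists (X `|` graph)%classic; [exact: FP|split; [by left|left; exact: YX|exact: sub]].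
    - by exists (X `|` graph)%classic; [exact: FP|split; [left|right|exact: sub]].
    - by exists (Y `|` graph)%classic; [exact: FP|split; [right|left|exact: sub]].
    - by exists graph => //; split=> // w; right.
  split=> [c u v hu hv|m hm].
    have [G [linG _] [Gu Gv sub]] := two _ _ hu hv.
    by apply: sub; apply: linG.
  by have [G [_ funG] [Gm _ _]] := two _ _ hm hm; apply: funG.
set G := (A0 `|` graph)%classic in linA funA.
have G00 : G (0, 0).
  right; exists 0; rewrite linear0; congr pair.
  by have := Kg (-1) 0 0; rewrite scaler0 addr0 mpolyCN mpolyC1 scaleN1r addNr.
have GZ c u : G u -> G (c%:MP *: u.1, c%:MP *: u.2).
  by move=> Gu; have := linA c _ _ Gu G00; rewrite !addr0.
have total b : exists m, G (b, m).
  apply: contrapT => nb.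
  (* If [b] had no value, sending it to [0] would enlarge the maximal partial map. *)
  pose G' : set (B * M) :=
    fun u => exists (c : K) v, G v /\ u = (c%:MP *: b + v.1, v.2).
  have GG' : (G `<=` G')%classic.
    by move=> [u1 u2] Gu; exists 0, (u1, u2); rewrite mpolyC0 scale0r add0r.
  apply: (maxA G').
    split=> [u Au|/(_ (b, 0)) sub]; first by apply: GG'; left.
    apply: nb; exists 0; left; apply: sub; exists 1, (0, 0).
    by split=> //; rewrite mpolyC1 scale1r addr0.
  rewrite /mkset; have -> : (G' `|` graph)%classic = G'.
    by apply/seteqP; split=> [u []|u G'u]; [|move=> gu; apply: GG'; right|left].
  split=> [c _ _ [d [v [Gv ->]]] [e [w [Gw ->]]]|m [c [v [Gv [e ->]]]]] /=.
    exists (c * d + e), (c%:MP *: v.1 + w.1, c%:MP *: v.2 + w.2); split; first exact: linA.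
    congr pair; rewrite /= scalerDr scalerA mpolyCD mpolyCM scalerDl.
    by rewrite addrACA.
  have [c0|nz_c] := eqVneq c 0.
    by apply: funA; rewrite e c0 mpolyC0 scale0r add0r -surjective_pairing.
  (* A relation with [c] nonzero expresses [b] through the domain, where it then has a value. *)
  case: nb; exists ((- c^-1)%:MP *: v.2); move: (GZ (- c^-1) _ Gv).
  suff -> : (- c^-1)%:MP *: v.1 = b by [].
  move/eqP: e; rewrite eq_sym addr_eq0 => /eqP /(congr1 (fun z => (c^-1)%:MP *: z)).
  by rewrite scalerA -mpolyCM mulVf // mpolyC1 scale1r => ->; rewrite mpolyCN scaleNr scalerN.
have [h hG] := choice total.
have func b m m' : G (b, m) -> G (b, m') -> m = m'.
  move=> Gm Gm'; apply/eqP; rewrite -subr_eq0; apply/eqP/funA.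
  have := linA (-1) _ _ Gm' Gm; rewrite /= mpolyCN mpolyC1 !scaleN1r.
  by rewrite addNr addrC.
exists h => [c x y|a]; last by apply: func (hG _) _; right; exists a.
by apply: func (hG _) _; exact: (linA c _ _ (hG x) (hG y)).
Qed.

End Extension.

Lemma mono_ext_K_linear M (f : R -> M) (r : R) :
  (forall (c : K) x y, f (c *: x + y) = c%:MP *: f x + f y) ->
  mono_ext (fun b => f 'X_[b]) r = f r.
Proof.
move=> Kf; elim/mpolyind: r => [|c b r _ _ IHr].
  have := Kf (-1) 0 0; rewrite scaler0 addr0 mpolyCN mpolyC1 scaleN1r addNr => ->.
  exact: mono_ext0r.
by rewrite mono_extD mono_extZ mono_extX IHr Kf.
Qed.

(** Evaluation at the monomial [1] turns [R]-linear maps into [Hom_K(R, M)] into [K]-linear maps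
    into [M], and those extend because [K] is a field. *)
Lemma cofree_injective M : injective_module (cofree M).
Proof.
move=> A B f g inj_f.
have [|h Kh hf] := @K_linear_extension A B M f (fun a => g a 0%MM) inj_f.
  by move=> c x y; rewrite linearP cofreeD cofreeZC.
have h0 : h 0 = 0.
  by have := Kh (-1) 0 0; rewrite scaler0 addr0 mpolyCN mpolyC1 scaleN1r addNr.
pose H (b : B) : cofree M := fun a => h ('X_[a] *: b).
have linH : linear H.
  move=> r x y; apply/funext => a; rewrite cofreeD cofreeZE /H.
  have -> : h ('X_[a] *: (r *: x + y)) = h ('X_[a] *: (r *: x)) + h ('X_[a] *: y).
    by rewrite scalerDr -[in LHS](scale1r (_ *: (r *: x))) -mpolyC1 Kh mpolyC1 scale1r.
  congr (_ + _); rewrite scalerA -[LHS](@mono_ext_K_linear _ (fun s => h (('X_[a] * s) *: x))).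
    by apply: eq_mono_ext => b; rewrite mpolyXD.
  move=> c u v; rewrite mulrDr -scalerAr scalerDl -mul_mpolyC -[(c%:MP * _) *: x]scalerA.
  exact: Kh.
exists (to_linear linH) => x; apply/funext => a.
by rewrite /= /H -linearZ hf linearZ /= cofreeZX add0m.
Qed.

Lemma zero_module_injective : injective_module (zero_module K n).
Proof.
move=> A B f g _.
have l0 : linear (fun _ : B => 0 : zero_module K n).
  by move=> a x y; rewrite scaler0 addr0.
by exists (to_linear l0) => x; rewrite (zero_moduleE (g x)).
Qed.

Lemma pair_injective M N :
  injective_module M -> injective_module N -> injective_module (M * N)%type.
Proof.
move=> injM injN A B f g inj_f.
have lg1 : linear (fun a => (g a).1) by move=> a x y; rewrite linearP.
have lg2 : linear (fun a => (g a).2) by move=> a x y; rewrite linearP.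
have [h1 e1] := injM _ _ f (to_linear lg1) inj_f.
have [h2 e2] := injN _ _ f (to_linear lg2) inj_f.
have lh : linear (fun b => (h1 b, h2 b)) by move=> a x y; rewrite !linearP.
by exists (to_linear lh) => x; rewrite /= e1 e2 -surjective_pairing.
Qed.

Lemma koszul_injective M (s : seq 'I_n) p : injective_module (ob (koszul M s) p).
Proof.
elim: s p => [|l s IHs] [|p]; first exact: cofree_injective.
- exact: zero_module_injective.
- exact: (IHs 0%N).
- by apply: pair_injective; apply: IHs.
Qed.

Lemma koszul_resolution M (s : seq 'I_n) : uniq s -> (forall l, l \in s) ->
  injective_resolution (E := ob (koszul M s)) (to_linear (@cofree_unit_lin K n M))
    (fun i => to_linear (@dif_lin _ _ _ (koszul M s) i)).
Proof.
move=> us all_s; split.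
- exact: koszul_injective.
- exact: cofree_unit_inj.
- by move=> x; apply: koszul_cocycle0.
- move=> i x; split=> [dx|[y <-]]; last exact: dif_dif.
  (* For the empty set of variables [ann_vars] is the whole module, so [koszul_exact] covers the
     full complex. *)
  have ann0 : prd (ann_vars K (pred0 : pred 'I_n)) x by move=> r [l].
  have [l _|y _ <-] := @koszul_exact _ _ M s pred0 i.+1 us _ isT x ann0 dx; first by [].
  by exists y.
Qed.

End Injectives.

(** * Subquotients *)

Section Subquotients.
Variables (A : comNzRingType) (M : lmodType A) (Z B : M -> Prop).
Hypothesis Z0 : Z 0.
Hypothesis Z_lin : forall a x y, Z x -> Z y -> Z (a *: x + y).
Hypothesis B0 : B 0.
Hypothesis B_lin : forall a x y, B x -> B y -> B (a *: x + y).
Hypothesis BZ : forall x, B x -> Z x.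

(** A chosen representative of the coset of [x] modulo [B]; the quotient is built on the chosen
    representatives lying in [Z]. *)
Let canon (x : M) : M := choose (fun y => `[< B (y - x) >]) x.

Let canonP x : B (canon x - x).
Proof.
by apply/asboolP; apply: (@chooseP _ (fun y => `[< B (y - x) >]) x); apply/asboolP; rewrite subrr.
Qed.

Let BD x y : B x -> B y -> B (x + y).
Proof. by move=> Bx By; rewrite -[x]scale1r; apply: B_lin. Qed.

Let BN x : B x -> B (- x).
Proof. by move=> Bx; rewrite -[- x]addr0 -scaleN1r; apply: B_lin. Qed.

Let canon_eq x y : B (x - y) -> canon x = canon y.
Proof.
move=> Bxy; rewrite /canon.
have /eq_choose -> : (fun z => `[< B (z - x) >]) =1 (fun z => `[< B (z - y) >]).
  move=> z; apply: asbool_equiv_eq; split=> Bz.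
    by rewrite -[z](subrK x) -addrA; apply: BD.
  by rewrite -[z](subrK y) -addrA; apply: BD => //; rewrite -opprB; apply: BN.
by apply: choose_id; apply/asboolP; rewrite ?subrr.
Qed.

Let canon_Z x : Z x -> Z (canon x).
Proof.
move=> Zx; rewrite -[canon x](subrK x) -[_ - _]scale1r; apply: Z_lin => //.
by apply: BZ; apply: canonP.
Qed.

Local Notation rep := {x : M | `[< Z x >] && (canon x == x)}.

Let mk_proof x : Z x -> `[< Z (canon x) >] && (canon (canon x) == canon x).
Proof.
move=> Zx; apply/andP; split; first by apply/asboolP; apply: canon_Z.
by apply/eqP/canon_eq; apply: canonP.
Qed.

(** Outside [Z] the value is the class of [0], which [is_subquotient] never inspects. *)
Let mk x : rep :=
  if pselect (Z x) is left Zx then exist _ (canon x) (mk_proof Zx)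
  else exist _ (canon 0) (mk_proof Z0).

Let val_mk x : Z x -> val (mk x) = canon x.
Proof. by rewrite /mk; case: pselect. Qed.

Let repZ (u : rep) : Z (val u).
Proof. by have /andP [/asboolP] := valP u. Qed.

Let repK (u : rep) : mk (val u) = u.
Proof. by apply: val_inj; rewrite val_mk //; have /andP [_ /eqP] := valP u. Qed.

Let mk_eq x y : Z x -> Z y -> mk x = mk y <-> B (x - y).
Proof.
move=> Zx Zy; split=> [/(congr1 val)|/canon_eq e]; last first.
  by apply: val_inj; rewrite !val_mk.
rewrite !val_mk // => e.
rewrite -(subrK (canon x) x) -addrA; apply: BD.
  by rewrite -opprB; apply: BN.
by rewrite e.
Qed.

Let ZD x y : Z x -> Z y -> Z (x + y).
Proof. by move=> Zx Zy; rewrite -[x]scale1r; apply: Z_lin. Qed.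

Let ZZ a x : Z x -> Z (a *: x).
Proof. by move=> Zx; rewrite -[_ *: x]addr0; apply: Z_lin. Qed.

Let ZN x : Z x -> Z (- x).
Proof. by rewrite -scaleN1r; apply: ZZ. Qed.

Let repD (u v : rep) : rep := mk (val u + val v).
Let repN (u : rep) : rep := mk (- val u).
Let rep0 : rep := mk 0.
Let repS (a : A) (u : rep) : rep := mk (a *: val u).

Let mkD x y : Z x -> Z y -> repD (mk x) (mk y) = mk (x + y).
Proof.
move=> Zx Zy; apply/mk_eq; rewrite ?val_mk //; try by apply: ZD => //; apply: canon_Z.
by rewrite opprD addrACA; apply: BD.
Qed.

Let mkN x : Z x -> repN (mk x) = mk (- x).
Proof.
move=> Zx; apply/mk_eq; rewrite ?val_mk //; try by apply: ZN => //; apply: canon_Z.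
by rewrite -opprD; apply: BN.
Qed.

Let mkS a x : Z x -> repS a (mk x) = mk (a *: x).
Proof.
move=> Zx; apply/mk_eq; rewrite ?val_mk //; try by apply: ZZ => //; apply: canon_Z.
by rewrite -scalerBr -[_ *: _]addr0; apply: B_lin.
Qed.

Let repE (u : rep) : exists2 x, Z x & u = mk x.
Proof. by exists (val u). Qed.

Let repDA : associative repD.
Proof.
move=> u v w; have [x Zx ->] := repE u; have [y Zy ->] := repE v; have [z Zz ->] := repE w.
by rewrite !mkD ?addrA //; apply: ZD.
Qed.

Let repDC : commutative repD.
Proof. by move=> u v; rewrite /repD addrC. Qed.

Let rep0D : left_id rep0 repD.
Proof. by move=> u; have [x Zx ->] := repE u; rewrite mkD // add0r. Qed.

Let repND : left_inverse rep0 repN repD.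
Proof.
by move=> u; have [x Zx ->] := repE u; rewrite mkN // mkD ?addNr //; apply: ZN.
Qed.

Let rep_zmod : zmodType := HB.pack rep (GRing.isZmodule.Build rep repDA repDC rep0D repND).

Let repSA a b (u : rep_zmod) : repS a (repS b u) = repS (a * b) u.
Proof. by have [x Zx ->] := repE u; rewrite !mkS ?scalerA //; apply: ZZ. Qed.

Let rep1S : left_id 1 (repS : A -> rep_zmod -> rep_zmod).
Proof. by move=> u; have [x Zx ->] := repE u; rewrite mkS ?scale1r. Qed.

Let repSDr : right_distributive (repS : A -> rep_zmod -> rep_zmod) +%R.
Proof.
move=> a u v; have [x Zx ->] := repE u; have [y Zy ->] := repE v.
rewrite -[LHS]/(repS a (repD (mk x) (mk y))) mkD // !mkS //; last exact: ZD.
by rewrite scalerDr -mkD //; apply: ZZ.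
Qed.

Let repSDl (u : rep_zmod) : {morph (repS : A -> rep_zmod -> rep_zmod)^~ u : a b / a + b}.
Proof.
move=> a b; have [x Zx ->] := repE u; rewrite /= !mkS // scalerDl -mkD //; exact: ZZ.
Qed.

Lemma subquotient_exists : exists H : lmodType A, is_subquotient Z B H.
Proof.
pose H : lmodType A := HB.pack rep rep_zmod
  (GRing.Zmodule_isLmodule.Build A rep_zmod repSA rep1S repSDr repSDl).
exists H, (mk : M -> H); split.
- move=> a x y Zx Zy.
  by rewrite -[RHS]/(repD (repS a (mk x)) (mk y)) mkS // mkD //; apply: ZZ.
- by move=> u; have [x Zx ->] := repE u; exists x.
- by move=> x Zx; rewrite -[0]/(mk 0) mk_eq // subr0.
Qed.

End Subquotients.

Section Subquotient_maps.
Variables (A : comNzRingType) (M H : lmodType A) (Z B : M -> Prop) (pi : M -> H).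
Hypothesis pi_lin : forall a x y, Z x -> Z y -> pi (a *: x + y) = a *: pi x + pi y.
Hypothesis Z0 : Z 0.

Lemma subquotient0 : pi 0 = 0.
Proof.
have := pi_lin 1 Z0 Z0; rewrite !scale1r addr0 => /eqP.
by rewrite -subr_eq subrr eq_sym => /eqP.
Qed.

Lemma subquotientZ a x : Z x -> pi (a *: x) = a *: pi x.
Proof. by move=> Zx; have := pi_lin a Zx Z0; rewrite subquotient0 !addr0. Qed.

Lemma subquotientB x y : Z x -> Z y -> pi (x - y) = pi x - pi y.
Proof.
move=> Zx Zy; have := pi_lin (-1) Zy Zx.
by rewrite !scaleN1r addrC [X in _ = X]addrC.
Qed.
End Subquotient_maps.

(** * Ext from the residue field *)

Section SpanIdeals.
Variable A : comNzRingType.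

Lemma span_ideal0 (s : seq A) : span_ideal s 0.
Proof. by exists (fun=> 0); rewrite big1 // => i _; rewrite mul0r. Qed.

Lemma span_idealD (s : seq A) a b : span_ideal s a -> span_ideal s b -> span_ideal s (a + b).
Proof.
move=> [c ->] [d ->]; exists (fun i => c i + d i).
by rewrite -big_split; apply: eq_bigr => i _; rewrite mulrDl.
Qed.

Lemma span_idealMl (s : seq A) a b : span_ideal s b -> span_ideal s (a * b).
Proof.
move=> [c ->]; exists (fun i => a * c i).
by rewrite mulr_sumr; apply: eq_bigr => i _; rewrite mulrA.
Qed.

Lemma span_ideal_mem (s : seq A) a : a \in s -> span_ideal s a.
Proof.
move=> sa; have lt_as : (index a s < size s)%N by rewrite index_mem.
exists (fun i => (i == index a s)%:R).
rewrite (bigD1 (Ordinal lt_as)) //= eqxx mul1r nth_index // big1 ?addr0 // => i.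
by rewrite -val_eqE /= => /negbTE ->; rewrite mul0r.
Qed.

Lemma span_ideal_ind (s : seq A) (P : A -> Prop) :
  P 0 -> (forall a b, P a -> P b -> P (a + b)) ->
  (forall c a, a \in s -> P (c * a)) -> forall a, span_ideal s a -> P a.
Proof.
move=> P0 PD PM _ [c ->]; apply: big_ind => // i _.
by apply: PM; apply: mem_nth.
Qed.

End SpanIdeals.

Section Ext.
Variables (K : fieldType) (n : nat).
Local Notation R := {mpoly K[n]}.
Variables (H N X : lmodType R) (s : seq 'I_n) (p : nat).
Hypothesis us : uniq s.
Hypothesis all_s : forall l, l \in s.

Local Notation E := (koszul H s).
Local Notation U := (ann_vars K (predT : pred 'I_n)).

Lemma ann_max_ideal (M : lmodType R) (y : M) r :
  prd U y -> max_ideal r -> r *: y = 0.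
Proof.
move=> Uy; apply: (span_ideal_ind (P := fun r => r *: y = 0)) => [|a b ay by_|c _ /mapP [l _ ->]].
- exact: scale0r.
- by rewrite scalerDl ay by_ addr0.
- by rewrite -scalerA Uy ?scaler0 //; exists l.
Qed.

(** A homomorphism from [N = R/m] is determined by the image of the class of [1], which can be any
    element killed by all variables. Hence [Hom(N, E)] is the [U]-part of [E]. *)
Lemma Ext_koszul :
  is_quotient_ring_module (@max_ideal K n) N ->
  is_subquotient (fun y : ob E p => prd U y /\ dif E y = 0) (fun y => is_bnd U y) X ->
  is_Ext p N H X.
Proof.
move=> [pi [pi_lin pi_onto pi_ker]] [q [q_lin q_onto q_ker]].
have piZ r : pi r = r *: pi 1.
  by rewrite -[r in LHS]mulr1; apply: (subquotientZ pi_lin).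
have /choice [c cP] : forall v : N, exists r, v = r *: pi 1.
  by move=> v; have [r _ <-] := pi_onto v; exists r.
have lift (Y : lmodType R) (y : Y) : prd U y ->
    exists g : N -> Y, linear g /\ g (pi 1) = y.
  move=> Uy.
  have wd r t : r *: pi 1 = t *: pi 1 -> r *: y = t *: y.
    move=> /eqP; rewrite -subr_eq0 -scalerBl -piZ => /eqP /pi_ker h.
    by apply/eqP; rewrite -subr_eq0 -scalerBl (ann_max_ideal Uy) //; apply: h.
  exists (fun v => c v *: y); split=> [a u v|].
    rewrite scalerA -scalerDl; apply: wd.
    by rewrite -cP scalerDl -scalerA -!cP.
  by rewrite -[RHS]scale1r; apply: wd; rewrite -cP scale1r.
have ext_hom (Y : lmodType R) (f g : N -> Y) : linear f -> linear g ->
    f (pi 1) = g (pi 1) -> f = g.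
  by move=> lf lg e; apply/funext => v; rewrite [v]cP linZ // linZ // e.
have ann_hom (Y : lmodType R) (f : N -> Y) : linear f -> prd U (f (pi 1)).
  move=> lf _ [l _ ->]; rewrite -linZ // -piZ.
  have -> : pi 'X_l = 0 by apply/pi_ker => //; apply/span_ideal_mem/map_f/mem_enum.
  exact: lin0.
exists (ob E), (to_linear (@cofree_unit_lin K n H)), (fun i => to_linear (@dif_lin _ _ _ E i)).
split; first exact: koszul_resolution.
have Zval f : cocycle (C := fun i => (N -> ob E i) : lmodType R)
    (fun i f => to_linear (@dif_lin _ _ _ E i) \o f) (fun i f => linear f) (j := p) f ->
    prd U (f (pi 1)) /\ dif E (f (pi 1)) = 0.
  move=> [lf df]; split; first exact: ann_hom.
  exact: (congr1 (fun g => g (pi 1)) df).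
exists (fun f => q (f (pi 1))); split.
- by move=> a f g /Zval Zf /Zval Zg; apply: q_lin.
- move=> h; have [y [Uy dy] <-] := q_onto h; have [g [lg gy]] := lift _ _ Uy.
  exists g; last by rewrite gy.
  split=> //; apply: ext_hom => [a u v|a u v|] /=.
  + by rewrite lg dif_lin.
  + by rewrite scaler0 addr0.
  + by rewrite gy.
- move=> f Zf; have /q_ker -> := Zval _ Zf; have [lf df] := Zf.
  case: p f {q q_lin q_onto q_ker Zval} Zf lf df => [|k] f Zf lf df /=; split.
  + by move=> f1; apply: ext_hom => // a u v; rewrite scaler0 addr0.
  + by move=> ->.
  + move=> [w Uw dw]; have [g [lg gw]] := lift _ _ Uw; exists g => //.
    apply: ext_hom => // [a u v|] /=; last by rewrite gw.
    by rewrite lg dif_lin.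
  + by move=> [g lg <-]; exists (g (pi 1)) => //; apply: ann_hom.
Qed.

End Ext.

(** * Monomials in powers of cover ideals *)

Section VariableIdeals.
Variables (K : fieldType) (n : nat).
Local Notation R := {mpoly K[n]}.
Implicit Types (A : pred 'I_n) (r s : R) (b c : 'X_{1..n}).

(* The ideal generated by the variables in [A]. *)
Definition vars_ideal A r : Prop :=
  forall b, (forall l, A l -> b l = 0%N) -> r@_b = 0.

Lemma mcoeffXM c r b : ('X_[c] * r)@_(c + b) = r@_b.
Proof. by rewrite mulrC mcoeffMX. Qed.

Lemma mcoeffXM_eq0 c r b : ~~ (c <= b)%MM -> ('X_[c] * r)@_b = 0.
Proof.
move=> ncb; apply/eqP; rewrite mcoeff_eq0 mulrC (perm_mem (msuppMX r c)).
apply: contra ncb => /mapP [d _ ->]; exact: lem_addr.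
Qed.

Definition mono_part (P : pred 'X_{1..n}) r : R :=
  \sum_(b <- msupp r | P b) r@_b *: 'X_[b].

Lemma mcoeff_mono_part P r b : (mono_part P r)@_b = if P b then r@_b else 0.
Proof.
rewrite raddf_sum /= (eq_bigr (fun c => if c == b then r@_b else 0)); last first.
  by move=> c _; rewrite mcoeffZ mcoeffX; case: eqP => [->|]; rewrite ?mulr1 ?mulr0.
have [rb|rb] := boolP (b \in msupp r); last first.
  rewrite (memN_msupp_eq0 rb) if_same big1 // => c _; exact: if_same.
rewrite big_mkcond (bigD1_seq b) //= eqxx big1 ?addr0 // => c /negbTE ->.
by rewrite if_same.
Qed.

Lemma mono_multiple c r : (forall b, ~~ (c <= b)%MM -> r@_b = 0) ->
  exists s, r = 'X_[c] * s.
Proof.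
move=> rc; exists (\sum_(b <- msupp r) r@_b *: 'X_[b - c]).
rewrite [LHS]mpolyE mulr_sumr; apply: eq_bigr => b _.
have [cb|/rc ->] := boolP (c <= b)%MM; last by rewrite !scale0r mulr0.
by rewrite -scalerAr -mpolyXD addmC submK.
Qed.

(** The left-hand side is the ideal that [cyclic_cone] produces. *)
Lemma vars_idealU1 A l r :
  (exists s, vars_ideal A (r - 'X_l * s)) <-> vars_ideal [pred i | (i == l) || A i] r.
Proof.
split=> [[s rs] b bA|rA].
  have <- : (r - 'X_l * s)@_b = 0 by apply: rs => i Ai; apply: bA; rewrite /= Ai orbT.
  by rewrite mcoeffB mcoeffXM_eq0 ?subr0 // lep1mP bA ?eqxx //= eqxx.
(* The witness is the quotient by ['X_l] of the part of [r] made of the monomials containing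
   ['X_l]. *)
have [|s rs] := @mono_multiple U_(l)%MM (mono_part (fun b => b l != 0%N) r).
  by move=> b; rewrite lep1mP mcoeff_mono_part => /negbTE ->.
exists s => b bA; rewrite -rs mcoeffB mcoeff_mono_part.
have [bl|_] := eqVneq (b l) 0%N; last by rewrite subrr.
by rewrite subr0 rA // => i /= /orP [/eqP ->|/bA].
Qed.

Lemma vars_ideal_regular A l r : ~~ A l -> vars_ideal A ('X_l * r) -> vars_ideal A r.
Proof.
move=> Al rA b bA; rewrite -(mcoeffXM U_(l)%MM) rA // => i Ai.
rewrite mnmDE mnm1E bA // addn0; case: eqP => // li.
by rewrite li Ai in Al.
Qed.

Lemma span_vars_ideal i j r : span_ideal [:: 'X_i; 'X_j] r ->
  vars_ideal [pred l | (l == i) || (l == j)] r.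
Proof.
apply: (span_ideal_ind (P := vars_ideal _)) => [b _|a c ha hc b hb|c a].
- exact: mcoeff0.
- by rewrite mcoeffD ha ?hc ?addr0.
- rewrite !inE => /orP [] /eqP -> b hb; rewrite mulrC mcoeffXM_eq0 // lep1mP;
    by rewrite hb ?eqxx //= eqxx ?orbT.
Qed.

Lemma mono_span i j b : (0 < b i + b j)%N -> span_ideal [:: 'X_i; 'X_j] ('X_[b] : R).
Proof.
have aux l : b l != 0%N -> exists s, 'X_[b] = s * 'X_l :> R.
  by move=> bl; exists 'X_[b - U_(l)]; rewrite -mpolyXD submK // lep1mP.
rewrite addn_gt0 => /orP []; rewrite lt0n => /aux [s ->];
  by apply/span_idealMl/span_ideal_mem; rewrite !inE eqxx ?orbT.
Qed.

End VariableIdeals.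

Section CoverIdeals.
Variables (K : fieldType) (n : nat) (e : rel 'I_n).
Local Notation R := {mpoly K[n]}.
Local Notation J := (@cover_ideal K n e).
Implicit Types (r s : R) (b c : 'X_{1..n}).

(* 'X_[b] lies in the k-th symbolic power of the cover ideal. *)
Definition sym_exp k b := forall i j, e i j -> (k <= b i + b j)%N.

Lemma cover_mono b : sym_exp 1 b -> J 'X_[b].
Proof. by move=> b1 i j eij; apply/mono_span/b1. Qed.

Lemma pow_ideal_exp (I : R -> Prop) k r : I r -> pow_ideal I k (r ^+ k).
Proof.
move=> Ir; elim: k => // k IHk; exists [:: (r, r ^+ k)] => [u|].
  by rewrite inE => /eqP ->.
by rewrite big_seq1 exprS.
Qed.

Lemma pow_cover_supp k r : pow_ideal J k r -> forall b, b \in msupp r -> sym_exp k b.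
Proof.
elim: k r => // k IHk r [s hs ->] b.
move/msupp_sum_le => /flattenP [t /mapP [u]].
rewrite mem_filter /= => us -> /msuppM_le /allpairsP [[c d] /= [uc ud ->]] i j eij.
have [Ju /IHk /(_ _ ud _ _ eij) dk] := hs u us.
have : (0 < c i + c j)%N.
  rewrite lt0n; apply: contraL uc; rewrite addn_eq0 => /andP [/eqP ci /eqP cj].
  rewrite -mcoeff_eq0; apply/eqP/(span_vars_ideal (Ju _ _ eij)) => l /=.
  by case/orP => /eqP ->.
rewrite !mnmDE; lia.
Qed.

(** Each edge has an end of exponent at least [k], so these vertices form a cover, and the [k]-th
    power of its squarefree monomial divides ['X_[b]]. *)
Lemma pow_cover_mono k b : sym_exp (2 * k) b -> pow_ideal J k 'X_[b].
Proof.
move=> bk; pose c : 'X_{1..n} := [multinom (k <= b i)%N : nat | i < n].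
have -> : b = (b - c *+ k + c *+ k)%MM.
  rewrite submK //; apply/mnm_lepP => i; rewrite mulmnE mnmE.
  by case: (leqP k (b i)) => ?; rewrite ?mul1n ?mul0n.
rewrite mpolyXD; apply: pow_idealMl; rewrite -mpolyXn; apply: pow_ideal_exp.
apply: cover_mono => i j eij; rewrite !mnmE; have := bk i j eij.
by case: (leqP k (b i)); case: (leqP k (b j)) => //=; lia.
Qed.

(** Ordinary and symbolic powers of [J] are cofinal, and membership of a monomial in a symbolic
    power is a condition on exponents. *)
Lemma torsion_cofree (M : lmodType R) (f : cofree M) :
  torsion J f <-> exists k, forall b, sym_exp k b -> f b = 0.
Proof.
split=> [[k fk]|[k fk]].
  exists (2 * k)%N => b bk; have /(congr1 (fun g : cofree M => g 0%MM)) := fk _ (pow_cover_mono bk).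
  by rewrite cofreeZX add0m.
exists k => r rk; apply/funext => a; rewrite cofreeZE /mono_ext big1_seq // => b /andP [_ rb].
rewrite fk ?scaler0 // => i j eij; rewrite !mnmDE.
have := pow_cover_supp rk rb eij; lia.
Qed.

(** A section of the action of ['X_[c]], extended by [0] to the monomials not divisible by
    ['X_[c]]. *)
Definition unshift (M : lmodType R) c (f : cofree M) : cofree M :=
  fun a => if (c <= a)%MM then f (a - c)%MM else 0.

Lemma unshiftK (M : lmodType R) c (f : cofree M) : 'X_[c] *: unshift c f = f.
Proof.
by apply/funext => a; rewrite cofreeZX /unshift lem_addl addmK.
Qed.

Lemma unshift_ann (M : lmodType R) c (A : pred 'I_n) (f : cofree M) :
  (forall l, A l -> c l = 0%N) ->
  prd (ann_vars K A) f -> prd (ann_vars K A) (unshift c f).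
Proof.
move=> cA /ann_varsP fA; apply/ann_varsP => l Al a; rewrite /unshift.
case: ifP => // /mnm_lepP ca.
have -> : (a + U_(l) - c = a - c + U_(l))%MM.
  apply/mnmP => i; have := ca i; rewrite !(mnmDE, mnmBE) !mnm1E.
  by case: eqP => [<-|_]; [rewrite cA // !subn0 | rewrite !addn0].
exact: fA.
Qed.

Lemma unshift_torsion (M : lmodType R) c (f : cofree M) :
  torsion J f -> torsion J (unshift c f).
Proof.
(* Subtracting [c] lowers each of the two exponents on an edge by at most [mdeg c]. *)
move/torsion_cofree => [k fk]; apply/torsion_cofree; exists (k + 2 * mdeg c)%N => b bk.
rewrite /unshift; case: ifP => // _; apply: fk => i j eij.
have := bk i j eij; rewrite !mnmBE.
have cm l : (c l <= mdeg c)%N by rewrite mdegE (bigD1 l) //= leq_addr.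
have := cm i; have := cm j; lia.
Qed.

End CoverIdeals.

(** * Kernels of scalars on complexes *)

Section KernelOfScalar.
Variables (K : fieldType) (n : nat).
Local Notation R := {mpoly K[n]}.
Variables (F : lmodType R) (C : bicomplex F) (U U1 : preradical R) (x : R).
Hypothesis U1P : forall (M : lmodType R) (y : M), prd U1 y <-> prd U y /\ x *: y = 0.
Hypothesis onto_x : forall p (y : ob C p), prd U y -> exists2 w, prd U w & x *: w = y.

Let difZ p a (y : ob C p) : dif C (a *: y) = a *: dif C y.
Proof. exact: (linZ (@dif_lin _ _ _ _ _)). Qed.

Let difB p (y w : ob C p) : dif C (y - w) = dif C y - dif C w.
Proof. exact: (linB (@dif_lin _ _ _ _ _)). Qed.

Lemma bnd_kernel p (y : ob C p) : is_bnd U1 y -> is_bnd U y.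
Proof. by case: p y => [|p] y //= [w /U1P [Uw _] <-]; exists w. Qed.

(** The cocycle [x *: v] is a boundary [dif C u]. Dividing [u] by [x] and subtracting the boundary
    of the result moves [v] into the kernel of [x] with [dif C v] unchanged. *)
Lemma kernel_preimage p (v : ob C p) : exact_at C U p -> prd U v -> x *: dif C v = 0 ->
  exists2 w : ob C p, prd U1 w & dif C w = dif C v.
Proof.
move=> exU Uv xdv; have := exU (x *: v) (prdZ _ Uv); rewrite difZ => /(_ xdv).
case: p v {exU} Uv xdv => [|p] v Uv xdv /=.
  by move=> xv; exists v => //; apply/U1P.
case=> u Uu du; have [u' Uu' xu'] := onto_x Uu.
exists (v - dif C u'); last by rewrite difB dif_dif subr0.
apply/U1P; split; first by apply: prdB => //; apply: prd_dif.
by rewrite scalerBr -difZ xu' du subrr.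
Qed.

Lemma kernel_bnd p (y : ob C p.+1) : exact_at C U p -> is_bnd U y -> x *: y = 0 -> is_bnd U1 y.
Proof.
by move=> exU [v Uv <-] xdv; have [w U1w dw] := kernel_preimage exU Uv xdv; exists w.
Qed.

Lemma kernel_exact p : exact_at C U p -> exact_at C U p.+1 -> exact_at C U1 p.+1.
Proof.
by move=> ex0 ex1 y /U1P [Uy xy] dy; apply: kernel_bnd => //; apply: ex1.
Qed.

(** In the long exact sequence of [0 -> U1 -> U -> U -> 0], the obstruction to dividing a cocycle by
    [x] is a class of [U1] in degree [p + 1]. *)
Lemma cocycle_divisible p (y : ob C p) : exact_at C U1 p.+1 -> prd U y -> dif C y = 0 ->
  exists w : ob C p, [/\ prd U w, dif C w = 0 & x *: w = y].
Proof.
move=> ex1 Uy dy; have [w Uw xw] := onto_x Uy.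
have [||t /U1P [Ut xt] dt] := ex1 (dif C w); last 1 first.
- by exists (w - t); rewrite difB dt subrr scalerBr xt subr0; split=> //; apply: prdB.
- by apply/U1P; split; [apply: prd_dif | rewrite -difZ xw].
- exact: dif_dif.
Qed.

(** Exactness in the middle of the same sequence: a class killed by [x] comes from [U1]. *)
Lemma cocycle_kernel p (y : ob C p) : prd U y -> dif C y = 0 -> is_bnd U (x *: y) ->
  exists w : ob C p, [/\ prd U1 w, dif C w = 0 & is_bnd U (y - w)].
Proof.
case: p y => [|p] y Uy dy /=.
  by move=> xy; exists y; split=> //; [apply/U1P | rewrite subrr].
case=> v Uv dv; have [w Uw xw] := onto_x Uv.
exists (y - dif C w); split; last by exists w; rewrite // opprB addrC subrK.
- apply/U1P; split; first by apply: prdB => //; apply: prd_dif.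
  by rewrite scalerBr -difZ xw dv subrr.
- by rewrite difB dif_dif dy subrr.
Qed.

End KernelOfScalar.

(** * Scalars acting on cohomology classes *)

Section Classes.
Variables (K : fieldType) (n : nat).
Local Notation R := {mpoly K[n]}.
Variables (F : lmodType R) (C : bicomplex F) (U U1 U2 : preradical R) (x x' : R).
Hypothesis U1P : forall (M : lmodType R) (y : M), prd U1 y <-> prd U y /\ x *: y = 0.
Hypothesis U2P : forall (M : lmodType R) (y : M), prd U2 y <-> prd U1 y /\ x' *: y = 0.
Hypothesis onto_x : forall p (y : ob C p), prd U y -> exists2 w, prd U w & x *: w = y.
Hypothesis onto_x' : forall p (y : ob C p), prd U1 y -> exists2 w, prd U1 w & x' *: w = y.

Variables (p : nat) (H : lmodType R) (pi : ob C p -> H).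
Local Notation Z := (fun y : ob C p => prd U y /\ dif C y = 0).
Hypothesis pi_lin : forall a y w, Z y -> Z w -> pi (a *: y + w) = a *: pi y + pi w.
Hypothesis pi_onto : forall h, exists2 y, Z y & pi y = h.
Hypothesis pi_ker : forall y, Z y -> (pi y = 0 <-> is_bnd U y).

Let Z0 : Z 0.
Proof. by split; [apply: prd0 | apply: (lin0 (@dif_lin _ _ _ _ _))]. Qed.

Let piZ a y : Z y -> pi (a *: y) = a *: pi y.
Proof. exact: (subquotientZ pi_lin Z0). Qed.

Let ZZ a y : Z y -> Z (a *: y).
Proof. by move=> [Uy dy]; split; [apply: prdZ | rewrite (linZ (@dif_lin _ _ _ _ _)) dy scaler0]. Qed.

Let ZB y w : Z y -> Z w -> Z (y - w).
Proof.
move=> [Uy dy] [Uw dw]; split; first exact: prdB.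
by rewrite (linB (@dif_lin _ _ _ _ _)) dy dw subrr.
Qed.

Let pi_eq y w : Z y -> Z w -> is_bnd U (y - w) -> pi y = pi w.
Proof.
move=> Zy Zw /(pi_ker (ZB Zy Zw)).
by rewrite (subquotientB (Z := Z) pi_lin) // => /subr0_eq.
Qed.

Lemma class_divisible (h : H) : exact_at C U1 p.+1 -> exists h' : H, x *: h' = h.
Proof.
move=> ex1; have [y [Uy dy] <-] := pi_onto h.
have [w [Uw dw <-]] := cocycle_divisible U1P onto_x ex1 Uy dy.
by exists (pi w); rewrite piZ.
Qed.

Lemma class_kernel (h : H) : x *: h = 0 ->
  exists w, [/\ prd U1 w, dif C w = 0 & pi w = h].
Proof.
have [y Zy <-] := pi_onto h; rewrite -piZ // => /(pi_ker (ZZ x Zy)) xy.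
have [Uy dy] := Zy; have [w [U1w dw yw]] := cocycle_kernel U1P onto_x Uy dy xy.
exists w; split=> //; apply/esym/pi_eq => //.
by split=> //; have /U1P [] := U1w.
Qed.

Lemma class_regular (h : H) : exact_at C U1 p -> x *: h = 0 -> h = 0.
Proof.
move=> ex1 /class_kernel [w [U1w dw <-]].
have [Uw _] := (U1P w).1 U1w; apply/pi_ker => //.
exact (bnd_kernel U1P (ex1 w U1w dw)).
Qed.

Lemma class_kernel_divisible (h : H) : exact_at C U2 p.+1 -> x *: h = 0 ->
  exists2 h' : H, x *: h' = 0 & x' *: h' = h.
Proof.
move=> ex2 /class_kernel [y [U1y dy <-]].
have [w [U1w dw <-]] := cocycle_divisible U2P onto_x' ex2 U1y dy.
have [Uw xw] := (U1P w).1 U1w.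
exists (pi w); last by rewrite piZ.
by rewrite -piZ // xw (subquotient0 pi_lin Z0).
Qed.

End Classes.

(** * The common kernel of two scalars on degree-two cohomology *)

Section Socle.
Variables (K : fieldType) (n : nat).
Local Notation R := {mpoly K[n]}.
Variables (F : lmodType R) (C : bicomplex F) (U U1 U2 : preradical R) (x x' : R).
Hypothesis U1P : forall (M : lmodType R) (y : M), prd U1 y <-> prd U y /\ x *: y = 0.
Hypothesis U2P : forall (M : lmodType R) (y : M), prd U2 y <-> prd U1 y /\ x' *: y = 0.
Hypothesis onto_x : forall p (y : ob C p), prd U y -> exists2 w, prd U w & x *: w = y.
Hypothesis onto_x' : forall p (y : ob C p), prd U1 y -> exists2 w, prd U1 w & x' *: w = y.
Hypotheses (ex0 : exact_at C U 0) (ex1 : exact_at C U 1).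

Variables (H : lmodType R) (pi : ob C 2 -> H).
Local Notation Z := (fun y : ob C 2 => prd U y /\ dif C y = 0).
Hypothesis pi_lin : forall a y w, Z y -> Z w -> pi (a *: y + w) = a *: pi y + pi w.
Hypothesis pi_onto : forall h, exists2 y, Z y & pi y = h.
Hypothesis pi_ker : forall y, Z y -> (pi y = 0 <-> is_bnd U y).

Variables (z : ob C 2) (I : R -> Prop).
Hypotheses (U2z : prd U2 z) (dz : dif C z = 0).
Hypothesis z_gen : forall y : ob C 2, prd U2 y -> dif C y = 0 ->
  exists r, is_bnd U2 (y - r *: z).
Hypothesis z_ann : forall r, is_bnd U2 (r *: z) <-> I r.

Let U1z : prd U1 z. Proof. by have [] := (U2P z).1 U2z. Qed.
Let Zz : Z z. Proof. by split=> //; have [] := (U1P z).1 U1z. Qed.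

(** Vanishing of the cohomology of [U] in degrees [0] and [1] makes [U1] exact in degree [1], so
    primitives can be moved from [U] to [U1] and then to [U2]. *)
Let bnd2 y : is_bnd U2 (y : ob C 2) <-> [/\ is_bnd U y, x *: y = 0 & x' *: y = 0].
Proof.
split=> [b2y|[by_ xy x'y]].
  have b1y := bnd_kernel U2P b2y; split; first exact (bnd_kernel U1P b1y).
    by have /U1P [] := bnd_prd b1y.
  by have /U2P [] := bnd_prd b2y.
apply: (kernel_bnd U2P onto_x') => //; first exact: (kernel_exact U1P onto_x).
exact: (kernel_bnd U1P onto_x).
Qed.

(** A class killed by [x] lifts to [U1]; killed by [x'] as well, it lifts to [U2]. With [bnd2] this
    identifies the common kernel with the degree-two cohomology of [U2]. *)
Lemma socle_generator : exists h0 : H,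
  (forall h : H, x *: h = 0 -> x' *: h = 0 -> exists r, h = r *: h0) /\
  (forall r, r *: h0 = 0 <-> I r).
Proof.
have Z0 : Z 0 by split; [apply: prd0 | apply: (lin0 (@dif_lin _ _ _ _ _))].
have ZZ a y : Z y -> Z (a *: y).
  by move=> [Uy dy]; split; [apply: prdZ | rewrite (linZ (@dif_lin _ _ _ _ _)) dy scaler0].
have piZ := subquotientZ pi_lin Z0.
exists (pi z); split=> [h|r].
  move=> /(class_kernel U1P onto_x pi_lin pi_onto pi_ker) [y [U1y dy <-]].
  have [Uy xy] := (U1P y).1 U1y.
  rewrite -piZ // => /(pi_ker (ZZ x' y (conj Uy dy))) bx'y.
  have b1 : is_bnd U1 (x' *: y).
    apply: (kernel_bnd U1P onto_x) => //.
    by rewrite scalerA mulrC -scalerA xy scaler0.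
  have [w [U2w dw b1w]] := cocycle_kernel U2P onto_x' U1y dy b1.
  have [r brw] := z_gen U2w dw; exists r; rewrite -piZ //.
  have byr : is_bnd U (y - r *: z).
    rewrite -[y](subrK w) -addrA; apply: bndD; first exact (bnd_kernel U1P b1w).
    by have [] := (bnd2 _).1 brw.
  have Zy : Z y by [].
  apply/subr0_eq; rewrite -(subquotientB (Z := Z) pi_lin) //; last exact: ZZ.
  apply/pi_ker => //; split; first by apply: prdB => //; have [] := ZZ r z Zz.
  by rewrite (linB (@dif_lin _ _ _ _ _)) dy (linZ (@dif_lin _ _ _ _ _)) dz scaler0 subrr.
rewrite -piZ // pi_ker; last exact: ZZ.
rewrite -z_ann bnd2; split=> [b|[] //].
have [_ xz] := (U1P z).1 U1z; have [_ x'z] := (U2P z).1 U2z.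
by split=> //; rewrite scalerA mulrC -scalerA ?xz ?x'z scaler0.
Qed.

End Socle.

(** * Local cohomology for a dominating vertex *)

Section DominatingVertex.
Variables (K : fieldType) (n : nat) (e : rel 'I_n) (x0 xn : 'I_n).
Local Notation R := {mpoly K[n]}.
Local Notation J := (@cover_ideal K n e).
Hypothesis e_irr : irreflexive e.
Hypothesis dom : forall j, j != xn -> e xn j.
Hypothesis neq_x0n : x0 != xn.

Definition other_vars : seq 'I_n := [seq l <- enum 'I_n | (l != x0) && (l != xn)].

Lemma other_vars_uniq : uniq other_vars.
Proof. by rewrite filter_uniq // enum_uniq. Qed.

Lemma x0_other : x0 \notin other_vars.
Proof. by rewrite mem_filter eqxx. Qed.

Lemma xn_other : xn \notin other_vars.
Proof. by rewrite mem_filter eqxx andbF. Qed.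

Local Notation s := [:: xn, x0 & other_vars].

Lemma order_uniq : uniq s.
Proof. by rewrite /= inE negb_or eq_sym neq_x0n x0_other xn_other other_vars_uniq. Qed.

Lemma order_all l : l \in s.
Proof. by rewrite !inE mem_filter mem_enum andbT; case: eqP; case: eqP. Qed.

Local Notation E := (koszul (R^o : lmodType R) s).
Local Notation T := (prd_tor J).
Local Notation T1 := (prd_meet T (prd_ann (fun r : R => r = 'X_xn))).
Local Notation E1 := (ann_vars K (pred1 xn)).
(** The predicate has the nested shape that two uses of [vars_idealU1] produce. *)
Local Notation T2 := (ann_vars K [pred i | (i == xn) || [pred i | (i == x0) || pred0 i] i]).

Lemma T1P (M : lmodType R) (y : M) : prd T1 y <-> prd T y /\ 'X_xn *: y = 0.
Proof. by split=> [[Ty h]|[Ty h]]; split=> //; [apply: h | move=> _ ->]. Qed.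

Lemma E1P (M : lmodType R) (y : M) : prd E1 y <-> 'X_xn *: y = 0.
Proof. by split=> [h|h r [l /= /eqP -> ->] //]; apply: h; exists xn => /=. Qed.

(** Since [xn] and [x0] are joined, [J] lies in the ideal of these two variables. *)
Lemma T2_torsion (M : lmodType R) (y : M) : 'X_x0 *: y = 0 -> 'X_xn *: y = 0 -> torsion J y.
Proof.
move=> x0y xny; exists 1%N => _ [t ht ->].
have e0n : e xn x0 by apply: dom.
rewrite scaler_suml big1_seq // => u /= /ht [Ju _]; rewrite mulrC -scalerA.
have -> : u.1 *: y = 0; last by rewrite scaler0.
move: (Ju _ _ e0n); apply: (span_ideal_ind (P := fun r => r *: y = 0)) => [|a b ay by_|c a].
- exact: scale0r.
- by rewrite scalerDl ay by_ addr0.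
- by rewrite !inE -scalerA => /orP [] /eqP ->; rewrite ?x0y ?xny scaler0.
Qed.

(** Torsion is automatic by [T2_torsion], so the common kernel on the torsion part is the one on the
    whole resolution. *)
Lemma T2P (M : lmodType R) (y : M) : prd T2 y <-> prd T1 y /\ 'X_x0 *: y = 0.
Proof.
split=> [h|[/T1P [_ xny] x0y]]; last first.
  by move=> r [l /= /orP [/eqP ->|/orP [/eqP ->|//]] ->].
have xny : 'X_xn *: y = 0 by apply: h; exists xn; rewrite //= eqxx.
have x0y : 'X_x0 *: y = 0 by apply: h; exists x0; rewrite //= eqxx orbT.
by split=> //; apply/T1P; split=> //; apply: T2_torsion.
Qed.

Definition all_but (i : 'I_n) : 'X_{1..n} := [multinom (j != i : nat) | j < n].

Lemma all_butE i j : all_but i j = (j != i). Proof. exact: mnmE. Qed.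

(** The complement of one vertex is a cover, because the two ends of an edge are distinct. *)
Lemma all_but_sym i k : sym_exp e k (all_but i *+ k)%MM.
Proof.
move=> a b eab; rewrite !mulmnE !all_butE.
have : a != b by apply/eqP => ab; rewrite ab e_irr in eab.
by case: (eqVneq a i) => [->|_]; case: (eqVneq b i) => [_|_] /=; rewrite ?eqxx //; lia.
Qed.

Lemma all_but_pow i k : pow_ideal J k 'X_[all_but i *+ k].
Proof.
rewrite -mpolyXn; apply: pow_ideal_exp; apply: cover_mono.
by have := @all_but_sym i 1; rewrite mulm1n.
Qed.

(** A monomial occurring in an element of [J^k] either contains ['X_xn] or, since [xn] is joined to
    every other vertex, has all other exponents at least [k]. *)
Lemma T1_torsionP (M : lmodType R) (y : M) :
  prd T1 y <-> 'X_xn *: y = 0 /\ exists k, 'X_[all_but xn *+ k] *: y = 0.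
Proof.
rewrite T1P; split=> [[[k ky] xny]|[xny [k ky]]].
  by split=> //; exists k; apply: ky; apply: all_but_pow.
split=> //; exists k => r rk; rewrite [r]mpolyE scaler_suml big1_seq // => b /= rb.
rewrite -mul_mpolyC -scalerA.
suff -> : 'X_[b] *: y = 0 by rewrite scaler0.
have [bn|bn] := eqVneq (b xn) 0%N.
  have cb : (all_but xn *+ k <= b)%MM.
    apply/mnm_lepP => i; rewrite mulmnE all_butE.
    have [->|ni] := eqVneq i xn; first by rewrite mul0n.
    by have := pow_cover_supp rk rb (dom ni); rewrite bn mul1n.
  by rewrite -(submK cb) mpolyXD -scalerA ky scaler0.
have cb : (U_(xn) <= b)%MM by rewrite lep1mP.
by rewrite -(submK cb) mpolyXD -scalerA xny scaler0.
Qed.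

Lemma onto_T p (y : ob E p) : prd T y -> exists2 w, prd T w & 'X_xn *: w = y.
Proof.
apply: koszul_onto => f Tf; exists (unshift U_(xn)%MM f); last exact: unshiftK.
exact: unshift_torsion.
Qed.

Lemma onto_T1 p (y : ob E p) : prd T1 y -> exists2 w, prd T1 w & 'X_x0 *: w = y.
Proof.
apply: koszul_onto => f /T1P [Tf /E1P E1f]; exists (unshift U_(x0)%MM f); last exact: unshiftK.
apply/T1P; split; first exact: unshift_torsion.
by apply/E1P/unshift_ann => // l /eqP ->; rewrite mnm1E (negbTE neq_x0n).
Qed.

Lemma onto_E1 k p (y : ob E p) : prd E1 y ->
  exists2 w, prd E1 w & 'X_[all_but xn *+ k] *: w = y.
Proof.
apply: koszul_onto => f E1f; exists (unshift (all_but xn *+ k)%MM f); last exact: unshiftK.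
by apply: unshift_ann => // l /eqP ->; rewrite mulmnE all_butE eqxx.
Qed.

(** [koszul_exact] applies to the variables other than [xn]; the outer cone on [xn] then costs one
    degree. *)
Lemma exact_E1 p : exact_at E E1 p.+2.
Proof.
have ex q : exact_at (koszul (R^o : lmodType R) (x0 :: other_vars)) E1 q.+1.
  apply: koszul_exact => //; first by have /andP [] := order_uniq.
  by move=> l; rewrite inE => /predU1P [->//|]; rewrite mem_filter => /andP [/andP []].
exact: cone_exact.
Qed.

(** [T1] is the union over [k] of the kernels of ['X_[all_but xn *+ k]] on [E1]. Each of these
    monomials acts onto, so a cocycle in one kernel bounds in that same kernel. *)
Lemma exact_T1 p : exact_at E T1 p.+3.
Proof.
move=> y /T1_torsionP [xny [k ky]] dy; have E1y := (E1P y).2 xny.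
have [v E1v dv] := exact_E1 E1y dy.
pose V := prd_meet E1 (prd_ann (fun r : R => r = 'X_[all_but xn *+ k])).
have VP (M : lmodType R) (w : M) : prd V w <-> prd E1 w /\ 'X_[all_but xn *+ k] *: w = 0.
  by split=> [[Ew h]|[Ew h]]; split=> //; [apply: h | move=> _ ->].
have [|w /VP [E1w kw] dw] := kernel_preimage VP (onto_E1 k) (@exact_E1 p) E1v.
  by rewrite dv.
exists w; last by rewrite dw.
by apply/T1_torsionP; split; [apply/E1P | exists k].
Qed.

Lemma mono_neq0 b : 'X_[b] != 0 :> R.
Proof.
apply/eqP => /(congr1 (mcoeff b)); rewrite mcoeffX eqxx mcoeff0 => /eqP.
by rewrite oner_eq0.
Qed.

(** A degree-[0] cocycle is an element of the domain [R], and every power of [J] contains a nonzero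
    monomial. *)
Lemma exact_T0 : exact_at E T 0.
Proof.
move=> y [k ky] /(koszul_cocycle0 _ order_all) [r rE] /=.
have := ky _ (all_but_pow xn k); rewrite -rE -(linZ (@cofree_unit_lin _ _ _)).
rewrite -[X in _ = X](lin0 (@cofree_unit_lin _ _ _)) => /cofree_unit_inj /eqP.
rewrite mulf_eq0 (negbTE (mono_neq0 _)) /= => /eqP ->.
exact: lin0 (@cofree_unit_lin _ _ _).
Qed.

(** A torsion cocycle [dif w] yields a map [rho] from [J^k] to [R] with [a w = rho a]. This map is
    multiplication by some [r], and then [w - r] is a torsion primitive. *)
Lemma exact_T_1 : exact_at E T 1.
Proof.
move=> y [k ky] dy.
have ann0 : prd (ann_vars K pred0) y by move=> r [l].
have [l _|//|w _ dw] := koszul_exact order_uniq _ _ ann0 dy; first by [].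
pose u (r : R) : ob E 0 := @cofree_unit _ _ (R^o : lmodType R) r.
have uZ a r : u (a * r) = a *: u r := linZ (@cofree_unit_lin _ _ (R^o : lmodType R)) a r.
have uI : injective u := @cofree_unit_inj _ _ (R^o : lmodType R).
have uP f : dif E f = 0 -> exists r, u r = f by move/(koszul_cocycle0 _ order_all).
have du r : dif E (u r) = 0 by apply/(koszul_cocycle0 _ order_all); exists r.
(* For [a] in [J^k] the element [a *: w] is a degree-[0] cocycle; off [J^k] the value of [rho] is
   arbitrary. *)
have /choice [rho rhoP] (a : R) : exists r : R, pow_ideal J k a -> u r = a *: w.
  have [Ja|] := pselect (pow_ideal J k a); last by exists 0.
  have [|r <-] := uP (a *: w); last by exists r.
  by rewrite (linZ (@dif_lin _ _ _ E 0)) dw ky.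
have rhoC a b : pow_ideal J k a -> pow_ideal J k b -> a * rho b = b * rho a.
  by move=> Ja Jb; apply: uI; rewrite !uZ !rhoP // !scalerA mulrC.
(* In [rhoC] with ['X_[all_but i *+ k]], which does not contain ['X_i], comparing exponents of [i]
   shows that ['X_i ^+ k] divides [rho 'X_[all_but xn *+ k]], for every [i] other than [xn]. *)
have [|r rE] := @mono_multiple K n (all_but xn *+ k)%MM (rho 'X_[all_but xn *+ k]).
  move=> b ncb.
  have [i] : exists i, ~~ ((all_but xn *+ k)%MM i <= b i)%N.
    by apply/existsP; rewrite -negb_forall; apply: contra ncb => /forallP h; apply/mnm_lepP.
  rewrite mulmnE all_butE; have [->|ni] := eqVneq i xn; first by rewrite mul0n.
  rewrite mul1n => nkb; rewrite -(mcoeffXM (all_but i *+ k)) rhoC; try exact: all_but_pow.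
  apply: mcoeffXM_eq0; apply: contra nkb => /mnm_lepP /(_ i).
  by rewrite mnmDE !mulmnE !all_butE eqxx ni mul1n.
exists (w - u r); last by rewrite (linB (@dif_lin _ _ _ E 0)) du subr0.
exists k => a Ja; rewrite scalerBr -uZ -rhoP //; apply/eqP; rewrite subr_eq0; apply/eqP.
congr u; apply: (mulfI (mono_neq0 (all_but xn *+ k)%MM)).
by rewrite (rhoC _ _ (all_but_pow xn k) Ja) rE mulrCA.
Qed.

Lemma eq_cyclic (U : preradical R) F (C : bicomplex F) t (z : ob C t) I I' :
  (forall r, I r <-> I' r) -> cyclic_cohomology U z I -> cyclic_cohomology U z I'.
Proof. by move=> II' [? ? ? ? annz]; split=> // r; rewrite annz. Qed.

(** The [K]-linear map [R -> R] that sets ['X_x0] and ['X_xn] to [0]. *)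
Definition socle0 : cofree (R^o : lmodType R) :=
  fun a => if (a x0 == 0%N) && (a xn == 0%N) then 'X_[a] else 0.

Lemma socle0_others l a : l \in other_vars -> socle0 (a + U_(l))%MM = 'X_l * socle0 a.
Proof.
rewrite mem_filter /socle0 !mnmDE !mnm1E => /andP [/andP [/negbTE -> /negbTE ->] _].
by rewrite !addn0; case: ifP; rewrite ?mulr0 // mpolyXD mulrC.
Qed.

Lemma T2_socle0 : prd T2 socle0.
Proof.
apply/ann_varsP => l l0n a; rewrite /socle0 !mnmDE !mnm1E.
by move: l0n => /= /orP [/eqP ->|/orP [/eqP ->|//]]; rewrite eqxx !addn1 ?andbF.
Qed.

(** A map linear in the other variables and zero on multiples of ['X_x0] and ['X_xn] is determined
    by its value at [1], so these maps are free on [socle0]; [vars_ideal pred0] is the zero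
    ideal. *)
Lemma cyclic_others :
  cyclic_cohomology T2 (socle0 : ob (koszul (R^o : lmodType R) other_vars) 0)
    (vars_ideal pred0).
Proof.
split.
- case=> // q _; apply: koszul_exact => //; first exact: other_vars_uniq.
  by move=> l; rewrite mem_filter /= orbF negb_or => /andP [/andP [-> ->]].
- exact: T2_socle0.
- by apply/koszul_dif0 => l lo a; apply: socle0_others.
- move=> y /ann_varsP yann /koszul_dif0 yo; exists (y 0%MM) => /=; apply/eqP.
  rewrite subr_eq0 koszul_act0; apply/eqP/funext => a; rewrite /value_act /socle0.
  case: ifP => [/andP [/eqP a0 /eqP an]|/negbT].
    have := @cocycle0_value _ _ _ _ _ yo 0%MM a; rewrite add0m => ->.
      exact: mulrC.
    move=> l; rewrite mem_filter mem_enum andbT negb_and !negbK.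
    by case/orP => /eqP ->.
  rewrite scaler0 negb_and -!lep1mP => /orP [] ca; rewrite -(submK ca);
    by apply: yann; rewrite /= eqxx ?orbT.
- move=> r /=; rewrite koszul_act0; split=> [|r0].
    move/(congr1 (fun f : cofree (R^o : lmodType R) => f 0%MM)).
    rewrite /value_act /socle0 !mnm0E /= mpolyX0 => rE b _.
    have -> : r = 0 by rewrite -[LHS]mulr1; exact: rE.
    exact: mcoeff0.
  have -> : r = 0 by apply/mpolyP => b; rewrite mcoeff0 r0.
  by apply/funext => a; rewrite /value_act scale0r.
Qed.

Definition socle_gen : ob E 2 := (0, (0, socle0)).

Lemma cyclic_T2 :
  cyclic_cohomology T2 socle_gen
    (vars_ideal [pred i | (i == xn) || [pred i | (i == x0) || pred0 i] i]).
Proof.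
apply: eq_cyclic (@vars_idealU1 K n _ xn) _; apply: cyclic_cone.
- by move=> p x Ux; apply: Ux; exists xn; rewrite //= eqxx.
- by move=> r; apply: vars_ideal_regular; rewrite /= orbF eq_sym.
apply: eq_cyclic (@vars_idealU1 K n _ x0) _; apply: cyclic_cone.
- by move=> p x Ux; apply: Ux; exists x0; rewrite //= eqxx orbT.
- by move=> r; apply: vars_ideal_regular.
exact: cyclic_others.
Qed.

(** [cyclic_T2] speaks of the action on values, local cohomology of the scalar action. On the
    generator they agree exactly for the other variables; for ['X_x0] and ['X_xn] one gives a
    boundary and the other [0]. *)
Lemma act_socle_gen r : is_bnd T2 (act E r socle_gen - r *: socle_gen).
Proof.
apply: bnd_act_scale => {r} l.
have [_ T2z _ _ annz] := cyclic_T2.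
have [lo|lo] := boolP (l \in other_vars).
  suff actX : act E 'X_l socle_gen = 'X_l *: socle_gen by rewrite actX subrr; apply: bnd0.
  congr pair; first by rewrite scaler0 (lin0 (@act_lin _ _ _ _ _ _)).
  congr pair; first by rewrite scaler0 (lin0 (@act_lin _ _ _ _ _ _)).
  rewrite /= koszul_act0; apply/funext => a; rewrite cofreeZX socle0_others //.
have l0n : (l == xn) || ((l == x0) || false).
  by move: lo; rewrite mem_filter mem_enum andbT negb_and !negbK orbF orbC.
have -> : 'X_l *: socle_gen = 0 by apply: T2z; exists l.
rewrite subr0; apply/annz => b bz; rewrite mcoeffX; case: eqP => // bE.
by have := bz l l0n; rewrite -bE mnm1E eqxx.
Qed.

Lemma local_cohomology_exists j : exists2 H : lmodType R,
    is_local_cohomology J j (R^o : lmodType R) H &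
  exists pi : ob E j -> H,
    let Z := (fun y : ob E j => prd T y /\ dif E y = 0) in
    [/\ forall a y w, Z y -> Z w -> pi (a *: y + w) = a *: pi y + pi w,
        forall h, exists2 y, Z y & pi y = h &
        forall y, Z y -> (pi y = 0 <-> is_bnd T y)].
Proof.
pose Z := (fun y : ob E j => prd T y /\ dif E y = 0).
have [|||||H HP] := @subquotient_exists _ (ob E j) Z (fun y => is_bnd T y).
- by split; [apply: prd0 | apply: (lin0 (@dif_lin _ _ _ _ _))].
- move=> a x y [Tx dx] [Ty dy]; split; first exact: prd_lin.
  by rewrite dif_lin dx dy scaler0 addr0.
- exact: bnd0.
- by move=> a x y; apply: bnd_lin.
- by move=> x bx; split; [apply: bnd_prd bx | apply: bnd_dif bx].
exists H => //.
exists (ob E), (to_linear (@cofree_unit_lin K n (R^o : lmodType R))).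
exists (fun i => to_linear (@dif_lin _ _ _ E i)); split=> //.
by apply: koszul_resolution; [apply: order_uniq | apply: order_all].
Qed.

Lemma local_cohomology_high j : exists2 H : lmodType R,
    is_local_cohomology J j.+3 (R^o : lmodType R) H &
  (forall h : H, 'X_xn *: h = 0 -> h = 0) /\
  (forall h : H, exists h', 'X_xn *: h' = h).
Proof.
have [H JH [pi [pi_lin pi_onto pi_ker]]] := local_cohomology_exists j.+3.
exists H => //; split=> h.
  apply: (class_regular T1P onto_T pi_lin pi_onto pi_ker); exact: exact_T1.
by apply: (class_divisible T1P onto_T pi_lin pi_onto); apply: exact_T1.
Qed.

Lemma local_cohomology_two : exists2 H : lmodType R,
    is_local_cohomology J 2 (R^o : lmodType R) H &
  exists h0 : H,
  [/\ forall h : H, exists h', 'X_xn *: h' = h,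
      forall h : H, 'X_xn *: h = 0 -> exists2 h' : H, 'X_xn *: h' = 0 & 'X_x0 *: h' = h,
      forall h : H, 'X_xn *: h = 0 -> 'X_x0 *: h = 0 -> exists r, h = r *: h0 &
      forall r, r *: h0 = 0 <->
        vars_ideal [pred i | (i == xn) || [pred i | (i == x0) || pred0 i] i] r].
Proof.
have [H JH [pi [pi_lin pi_onto pi_ker]]] := local_cohomology_exists 2.
have [exT2 T2z dz genz annz] := cyclic_T2.
have T2_3 : exact_at E T2 3 by apply: exT2.
have shift_gen y : prd T2 y -> dif E y = 0 -> exists r, is_bnd T2 (y - r *: socle_gen).
  move=> T2y dy; have [r br] := genz y T2y dy; exists r.
  rewrite -[y](subrK (act E r socle_gen)) -addrA.
  by apply: bndD => //; apply: act_socle_gen.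
have shift_ann r : is_bnd T2 (r *: socle_gen) <->
    vars_ideal [pred i | (i == xn) || [pred i | (i == x0) || pred0 i] i] r.
  rewrite -annz; split=> br.
    rewrite -[act E r _](subrK (r *: socle_gen)); apply: bndD => //.
    exact: act_socle_gen.
  rewrite -[r *: _](subrK (act E r socle_gen)); apply: bndD => //.
  by rewrite -opprB; apply/bndN/act_socle_gen.
have [h0 [h0_gen h0_ann]] := socle_generator T1P T2P onto_T onto_T1 exact_T0 exact_T_1
  pi_lin pi_onto pi_ker T2z dz shift_gen shift_ann.
exists H => //; exists h0; split=> //.
- by move=> h; apply: (class_divisible T1P onto_T pi_lin pi_onto); apply: exact_T1.
- by move=> h; apply: (class_kernel_divisible T1P T2P onto_T onto_T1 pi_lin pi_onto pi_ker).
Qed.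

End DominatingVertex.

(** * Bass numbers *)

Section BassNumbers.
Variables (K : fieldType) (n : nat).
Local Notation R := {mpoly K[n]}.
Local Notation U := (ann_vars K (predT : pred 'I_n)).

Section FromKoszul.
Variables (H : lmodType R) (s : seq 'I_n) (p : nat).
Hypotheses (us : uniq s) (all_s : forall l, l \in s).
Local Notation E := (koszul H s).

Lemma residue_field_exists : exists N : lmodType R, is_quotient_ring_module (@max_ideal K n) N.
Proof.
apply: (@subquotient_exists _ R^o) => //.
- exact: span_ideal0.
- by move=> a x y hx hy; apply: span_idealD => //; apply: span_idealMl.
Qed.

Lemma bass_numberP l :
  (forall (X : lmodType R) (q : ob E p -> X),
    (forall a y w, prd U y /\ dif E y = 0 -> prd U w /\ dif E w = 0 ->
       q (a *: y + w) = a *: q y + q w) ->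
    (forall h, exists2 y, prd U y /\ dif E y = 0 & q y = h) ->
    (forall y, prd U y /\ dif E y = 0 -> (q y = 0 <-> is_bnd U y)) -> has_dim X l) ->
  bass_number p H l.
Proof.
move=> dimX; have [N NP] := residue_field_exists.
have [|||||X XP] := @subquotient_exists _ (ob E p)
  (fun y => prd U y /\ dif E y = 0) (fun y => is_bnd U y).
- by split; [apply: prd0 | apply: (lin0 (@dif_lin _ _ _ _ _))].
- move=> a x y [Tx dx] [Ty dy]; split; first exact: prd_lin.
  by rewrite dif_lin dx dy scaler0 addr0.
- exact: bnd0.
- by move=> a x y; apply: bnd_lin.
- by move=> x bx; split; [apply: bnd_prd bx | apply: bnd_dif bx].
exists N, X; split=> //; first exact: (Ext_koszul us all_s).
by have [q [q_lin q_onto q_ker]] := XP; apply: dimX q_lin q_onto q_ker.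
Qed.

Lemma bass_number_exact : exact_at E U p -> bass_number p H 0.
Proof.
move=> exp; apply: bass_numberP => X q _ q_onto q_ker.
have X0 x : x = 0 :> X.
  by have [y [Uy dy] <-] := q_onto x; apply/q_ker => //; apply: exp.
exists (fun=> 0); split.
  by exists (fun=> 0) => [x|v]; [rewrite [x]X0 | rewrite [v]thinmx0].
by move=> c x y; rewrite scaler0 addr0.
Qed.

(** Here [I] is the maximal ideal, and the coordinate of a class is the constant coefficient of any
    [r] representing it. *)
Lemma bass_number_cyclic z (I : R -> Prop) : (forall r, I r <-> r@_0%MM = 0) ->
  @cyclic_cohomology K n U _ E p z I -> bass_number p H 1.
Proof.
move=> I0 [_ Uz dz genz annz]; apply: bass_numberP => X q q_lin q_onto q_ker.
have Z0 : prd U (0 : ob E p) /\ dif E (0 : ob E p) = 0.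
  by split; [apply: prd0 | apply: (lin0 (@dif_lin _ _ _ _ _))].
have Zact r : prd U (act E r z) /\ dif E (act E r z) = 0.
  by split; [apply: prd_act | rewrite dif_act dz (lin0 (@act_lin _ _ _ _ _ _))].
have q_act r t : q (act E r z) = q (act E t z) <-> r@_0%MM = t@_0%MM.
  have -> : q (act E r z) = q (act E t z) <-> q (act E r z - act E t z) = 0.
    rewrite (subquotientB q_lin) //.
    by split=> [->|/subr0_eq //]; rewrite subrr.
  rewrite -actBl q_ker // annz I0 mcoeffB.
  by split=> [/subr0_eq //|->]; rewrite subrr.
have /choice [c cP] x : exists r, x = q (act E r z).
  have [y [Uy dy] <-] := q_onto x; have [r br] := genz y Uy dy; exists r.
  apply/subr0_eq; rewrite -(subquotientB q_lin) //; apply/q_ker => //.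
  split; first by apply: prdB => //; apply: prd_act.
  by rewrite (linB (@dif_lin _ _ _ _ _)) dy (Zact r).2 subrr.
exists (fun x => const_mx ((c x)@_0%MM)); split.
  exists (fun v : 'rV[K]_1 => q (act E (v 0 0)%:MP z)) => [x|v].
    by rewrite mxE [RHS]cP; apply/q_act; rewrite mcoeffC eqxx mulr1.
  apply/matrixP => i j; rewrite !ord1 mxE.
  have /q_act -> : q (act E (c (q (act E (v 0 0)%:MP z))) z) = q (act E (v 0 0)%:MP z).
    by rewrite -cP.
  by rewrite mcoeffC eqxx mulr1.
move=> d x y; apply/matrixP => i j; rewrite !mxE.
have /q_act -> : q (act E (c (d%:MP *: x + y)) z) = q (act E (d%:MP * c x + c y) z).
  rewrite -cP actDl actM actC {1}[x]cP {1}[y]cP q_lin //.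
by rewrite mcoeffD mcoeffCM.
Qed.

End FromKoszul.

Section SocleFunctions.
Variable H : lmodType R.

(** The functions killed by all variables are those supported at the monomial [1]. They form a copy
    of [H] on which [defect l] acts as ['X_l]. *)
Definition delta (h : H) : cofree H := fun a => if a == 0%MM then h else 0.

Lemma ann_delta h : prd U (delta h).
Proof.
by apply/ann_varsP => l _ a; rewrite /delta mnmD_eq0 mnm1_eq0 andbF.
Qed.

Lemma ann_deltaE (f : cofree H) : prd U f -> f = delta (f 0%MM).
Proof.
move=> /ann_varsP f0; apply/funext => a; rewrite /delta; case: eqP => [->//|/eqP].
move=> a0; have [l al] : exists l, (U_(l) <= a)%MM.
  apply/existsP; apply: contraNT a0; rewrite negb_exists => /forallP h.
  by apply/eqP/mnmP => l; have := h l; rewrite lep1mP negbK mnm0E => /eqP.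
by rewrite -(submK al) f0.
Qed.

Lemma defect_delta s l h : defect l (delta h : ob (koszul H s) 0) = delta ('X_l *: h).
Proof.
have Ud : prd U (defect l (delta h : ob (koszul H s) 0)).
  by apply: prd_defect; apply: ann_delta.
rewrite (ann_deltaE Ud) koszul_defect0 /delta eqxx add0m mnm1_eq0 subr0 //.
Qed.

Lemma delta_eq0 h : delta h = 0 -> h = 0.
Proof. by move/(congr1 (fun f : cofree H => f 0%MM)); rewrite /delta eqxx. Qed.

Lemma delta_dif s h : {in s, forall l, 'X_l *: h = 0} -> dif (koszul H s) (p := 0) (delta h) = 0.
Proof.
move=> sh; apply/koszul_dif0 => l ls a; rewrite /delta mnmD_eq0 mnm1_eq0 andbF.
by case: eqP => _; rewrite ?sh // scaler0.
Qed.

Lemma dif_delta s h : dif (koszul H s) (p := 0) (delta h) = 0 -> {in s, forall l, 'X_l *: h = 0}.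
Proof.
move=> /koszul_dif0 sh l ls; have := sh l ls 0%MM.
by rewrite /delta mnmD_eq0 mnm1_eq0 andbF eqxx => <-.
Qed.

Lemma koszul_nil_exact p : exact_at (koszul H [::]) U p.+1.
Proof.
by move=> y _ _; exists (0 : ob (koszul H [::]) p); [exact: prd0 | rewrite (zero_moduleE y)].
Qed.

Lemma koszul_one_exact l p : (forall h : H, exists h', 'X_l *: h' = h) ->
  exact_at (koszul H [:: l]) U p.+1.
Proof.
move=> onto; case: p => [|p]; last by apply: cone_exact; apply: koszul_nil_exact.
apply: cone_exact1; last exact: koszul_nil_exact.
move=> y Uy _; have [h yh] := onto ((y : cofree H) 0%MM).
exists (delta h : ob (koszul H [::]) 0); split; first exact: ann_delta.
  exact: (@delta_dif [::]).
by rewrite [LHS](@defect_delta [::]) yh -ann_deltaE.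
Qed.

End SocleFunctions.

(** * Koszul cohomology of the local cohomology modules *)

Section DominatingVertexBass.
Variables (x0 xn : 'I_n) (H : lmodType R).
Hypothesis neq_x0n : x0 != xn.
Local Notation others := (other_vars x0 xn).
(** Now [xn] is innermost and [x0] next, so that divisibility by these two is used first; any order
    of the variables gives a resolution. *)
Local Notation order := (others ++ [:: x0; xn]).

Lemma bass_order_perm : perm_eq order [:: xn, x0 & others].
Proof. by apply/permP => a; rewrite count_cat /=; lia. Qed.

Lemma bass_order_uniq : uniq order.
Proof. by rewrite (perm_uniq bass_order_perm) order_uniq. Qed.

Lemma bass_order_all l : l \in order.
Proof. by rewrite (perm_mem bass_order_perm) order_all. Qed.

Lemma size_others : size others = (n - 2)%N.
Proof.
have : size [:: xn, x0 & others] = #|'I_n|.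
  rewrite cardE; apply/perm_size/uniq_perm; [exact: order_uniq|exact: enum_uniq|].
  by move=> l; rewrite mem_enum order_all.
by rewrite card_ord /=; lia.
Qed.

(** The cone on a bijective variable is acyclic, and further cones remain so. *)
Lemma bass_number_bijective p :
  (forall h : H, 'X_xn *: h = 0 -> h = 0) ->
  (forall h : H, exists h', 'X_xn *: h' = h) -> bass_number p H 0.
Proof.
move=> inj onto; apply: (bass_number_exact bass_order_uniq bass_order_all).
suff ex s q : exact_at (koszul H (s ++ [:: xn])) U q by rewrite -cat_rcons.
elim: s q => [|l s IHs] [|q].
- apply: cone_exact0 => a Ua _; rewrite (ann_deltaE Ua).
  rewrite [X in X = _ -> _](@defect_delta H [::]) => /delta_eq0 /inj ->; apply/funext => b.
  by rewrite /delta if_same.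
- exact: koszul_one_exact.
- by apply: cone_exact0 => a Ua da _; apply: (IHs 0%N).
- exact: cone_exact.
Qed.

Variable h0 : H.
Local Notation I0n := [pred i | (i == xn) || [pred i | (i == x0) || pred0 i] i].
Hypothesis xn_onto : forall h : H, exists h', 'X_xn *: h' = h.
Hypothesis x0_onto : forall h : H, 'X_xn *: h = 0 ->
  exists2 h' : H, 'X_xn *: h' = 0 & 'X_x0 *: h' = h.
Hypothesis h0_gen : forall h : H, 'X_xn *: h = 0 -> 'X_x0 *: h = 0 -> exists r, h = r *: h0.
Hypothesis h0_ann : forall r, r *: h0 = 0 <-> vars_ideal I0n r.

(** Positive degrees vanish because ['X_xn] is onto on [H] and ['X_x0] is onto on its kernel; degree
    [0] is the common kernel, generated by [h0]. *)
Lemma bass_cyclic_start :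
  cyclic_cohomology U (delta h0 : ob (koszul H [:: x0; xn]) 0) (vars_ideal I0n).
Proof.
have act_delta r : act (koszul H [:: x0; xn]) (p := 0) r (delta h0) = delta (r *: h0).
  by apply/funext => a; rewrite koszul_act0 /value_act /delta; case: eqP => // _; rewrite scaler0.
have kill l : I0n l -> 'X_l *: h0 = 0.
  move=> Il; apply/h0_ann => b bI; rewrite mcoeffX; case: eqP => // bE.
  by have := bI l Il; rewrite -bE mnm1E eqxx.
split.
- case=> // q _; case: q => [|q]; last first.
    by apply: cone_exact; apply: koszul_one_exact.
  apply: cone_exact1; last exact: koszul_one_exact.
  move=> y Uy; rewrite (ann_deltaE Uy) => /(@dif_delta H [:: xn]) dy.
  have [|h' xnh x0h] := @x0_onto ((y : cofree H) 0%MM); first by apply: dy; rewrite mem_head.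
  exists (delta h' : ob (koszul H [:: xn]) 0); split; first exact: ann_delta.
    by apply: (@delta_dif H [:: xn]) => l; rewrite inE => /eqP ->.
  by rewrite [LHS](@defect_delta H [:: xn]) x0h.
- exact: ann_delta.
- apply: (@delta_dif H [:: x0; xn]) => l; rewrite !inE => l0n; apply: kill.
  by rewrite /= orbF orbC.
- move=> y Uy; rewrite (ann_deltaE Uy) => /(@dif_delta H [:: x0; xn]) dy.
  have [||r rE] := h0_gen (h := (y : cofree H) 0%MM); [by apply: dy; rewrite !inE eqxx ?orbT..|].
  by exists r; rewrite rE -(act_delta r); apply: subrr.
- move=> r; rewrite -h0_ann; split=> [|r0]; first by move/(etrans (esym (act_delta r)))/delta_eq0.
  apply: (etrans (act_delta r)); rewrite r0.
  by apply/funext => a; rewrite /delta if_same.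
Qed.

(** Each variable of [s] is regular modulo the ideal reached so far, so each cone raises the degree
    by one. *)
Lemma bass_cyclic s : uniq s -> {in s, forall l, ~~ I0n l} ->
  exists z : ob (koszul H (s ++ [:: x0; xn])) (size s),
    cyclic_cohomology U z (vars_ideal [pred i | (i \in s) || I0n i]).
Proof.
elim: s => [|l s IHs] /=; first by exists (delta h0); apply: bass_cyclic_start.
move=> /andP [ls us] sI.
have [|z zP] := IHs us; first by move=> k ks; apply: sI; rewrite inE ks orbT.
exists (0, z); apply: (eq_cyclic (I := fun r => exists t,
    vars_ideal [pred i | (i \in s) || I0n i] (r - 'X_l * t))).
  move=> r; rewrite vars_idealU1; split=> h b hb; apply: h => i hi; apply: hb;
    by move: hi; rewrite /= !inE -!orbA.
apply: cyclic_cone => //.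
- by move=> p x Ux; apply: Ux; exists l.
- move=> r; apply: vars_ideal_regular; rewrite /= negb_or ls.
  by have := sI l; rewrite mem_head => /(_ isT).
Qed.

Lemma bass_cyclic_all : exists z : ob (koszul H order) (n - 2),
  cyclic_cohomology U z (vars_ideal [pred i | (i \in others) || I0n i]).
Proof.
rewrite -size_others; apply: bass_cyclic; first exact: other_vars_uniq.
by move=> l; rewrite mem_filter /= orbF negb_or => /andP [/andP [-> ->]].
Qed.

Lemma bass_number_top : bass_number (n - 2) H 1.
Proof.
have [z zP] := bass_cyclic_all.
apply: (bass_number_cyclic bass_order_uniq bass_order_all _ zP) => r.
split=> [h|r0 b hb]; first by apply: h => l; rewrite mnm0E.
suff -> : b = 0%MM by [].
apply/mnmP => l; rewrite mnm0E hb //= orbF mem_filter mem_enum andbT.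
by case: eqP; case: eqP.
Qed.

Lemma bass_number_below p : p <> (n - 2)%N -> bass_number p H 0.
Proof.
have [z [exz _ _ _ _]] := bass_cyclic_all => /exz.
exact: (bass_number_exact bass_order_uniq bass_order_all).
Qed.

End DominatingVertexBass.
End BassNumbers.

(** * Krull dimension *)

Section KillVariables.
Variables (K : fieldType) (n : nat) (A : pred 'I_n).
Local Notation R := {mpoly K[n]}.
Implicit Types (r t : R) (b : 'X_{1..n}).

Definition kill_vars : R -> R := mmap (@mpolyC n K) (fun l => if A l then 0 else 'X_l).

HB.instance Definition _ := GRing.RMorphism.on kill_vars.

Lemma kill_varsX b :
  kill_vars 'X_[b] = if [forall l, A l ==> (b l == 0%N)] then 'X_[b] else 0.
Proof.
rewrite /kill_vars mmapX; case: ifP => [/forallP bA|/negbT].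
  rewrite [RHS]mpolyXE_id; apply: eq_bigr => l _.
  by case: ifP => // Al; have := bA l; rewrite Al => /eqP ->; rewrite !expr0.
rewrite negb_forall => /existsP [l]; rewrite negb_imply => /andP [Al bl].
by rewrite /mmap1 (bigD1 l) //= Al expr0n (negbTE bl) mul0r.
Qed.

Lemma mcoeff_kill_vars r b :
  (kill_vars r)@_b = if [forall l, A l ==> (b l == 0%N)] then r@_b else 0.
Proof.
elim/mpolyind: r => [|c m r _ _ IHr]; first by rewrite rmorph0 mcoeff0 if_same.
rewrite rmorphD mcoeffD IHr -mul_mpolyC rmorphM /= [kill_vars c%:MP]mmapC kill_varsX.
rewrite mcoeffD !mcoeffCM mcoeffX; have [->|mb] := eqVneq m b.
  by case: ifP => _; rewrite ?mcoeffX ?eqxx // mcoeff0 mulr0 addr0.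
rewrite mulr0 add0r; case: ifP => _; rewrite ?mcoeffX ?(negbTE mb) ?mcoeff0 mulr0 add0r //.
Qed.

Lemma kill_varsP r : kill_vars r = 0 <-> vars_ideal A r.
Proof.
split=> [r0 b bA|rA].
  have := congr1 (mcoeff b) r0; rewrite mcoeff0 mcoeff_kill_vars.
  by have -> : [forall l, A l ==> (b l == 0%N)] by apply/forallP => l; apply/implyP => /bA ->.
apply/mpolyP => b; rewrite mcoeff0 mcoeff_kill_vars; case: ifP => // /forallP bA.
by apply: rA => l Al; have := bA l; rewrite Al => /eqP.
Qed.

(** By [kill_varsP] it is the kernel of a ring morphism into a domain. *)
Lemma vars_ideal_prime : is_prime_ideal (vars_ideal (K := K) A).
Proof.
split=> [|a b /kill_varsP ha /kill_varsP hb|a b /kill_varsP hb|/kill_varsP|a b /kill_varsP /eqP].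
- by apply/kill_varsP; rewrite rmorph0.
- by apply/kill_varsP; rewrite rmorphD /= ha hb addr0.
- by apply/kill_varsP; rewrite rmorphM /= hb mulr0.
- by rewrite rmorph1 => /eqP; rewrite oner_eq0.
- by rewrite rmorphM mulf_eq0 => /orP [] /eqP /kill_varsP; [left | right].
Qed.

End KillVariables.

(** * Algebraic independence along a chain of primes *)

Section BoxMonomials.
Variables (K : fieldType) (n D : nat).
Local Notation R := {mpoly K[n]}.

(** Exponent vectors of length [s] with entries below [D], as nested pairs so that an induction can
    peel off the first element of the chain. *)
Fixpoint box (s : nat) : finType := if s is t.+1 then ('I_D * box t)%type else unit.

Fixpoint box_mono (s : nat) (a : nat -> R) : box s -> R :=
  if s is t.+1 then fun u => a 0%N ^+ u.1 * box_mono (fun i => a i.+1) u.2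
  else fun _ => 1.

Lemma card_box s : #|box s| = (D ^ s)%N.
Proof. by elim: s => [|s IHs] /=; rewrite ?card_unit // card_prod card_ord IHs expnS. Qed.

(* Coquand-Lombardi: the elements a i of P i.+1 \ P i are algebraically
   independent modulo P 0. In a relation, factor out the largest power of a 0
   to get a relation between the remaining elements modulo P 1. *)
Lemma chain_independent s (P : nat -> R -> Prop) (a : nat -> R) (c : box s -> K) :
  (forall i, (i <= s)%N -> is_prime_ideal (P i)) ->
  (forall i, (i < s)%N -> forall r, P i r -> P i.+1 r) ->
  (forall i, (i < s)%N -> P i.+1 (a i) /\ ~ P i (a i)) ->
  P 0%N (\sum_u c u *: box_mono a u) -> forall u, c u = 0.
Proof.
elim: s P a c => [|s IHs] P a c Pp Pi Pa.
  rewrite (bigD1 tt) //= big1 ?addr0 => [Pc []|[] //].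
  apply: contrapT => /eqP nz; have [_ _ PM P1 _] := Pp 0%N isT.
  by apply: P1; have := PM (c tt)^-1%:MP _ Pc; rewrite mul_mpolyC scalerA mulVf ?scale1r.
pose q (k : 'I_D) := \sum_v c (k, v) *: box_mono (fun i => a i.+1) v.
have -> : \sum_u c u *: box_mono a u = \sum_(k < D) a 0%N ^+ k * q k.
  rewrite (eq_bigr (fun k : 'I_D => \sum_v c (k, v) *: (a 0%N ^+ k * box_mono (fun i => a i.+1) v))).
    by rewrite pair_big; apply: eq_bigr => -[k v].
  by move=> k _; rewrite mulr_sumr; apply: eq_bigr => v _; rewrite scalerAr.
move=> Psum.
have [P0p P1p] : is_prime_ideal (P 0%N) /\ is_prime_ideal (P 1%N) by split; apply: Pp.
have [P1a nP0a] := Pa 0%N isT.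
suff H k : forall v, c (k, v) = 0 by case=> k v; apply: H.
have [m] := ubnP (k : nat); elim: m k => // m IHm k /ltnSE le_km.
have qlow (j : 'I_D) : (j < k)%N -> q j = 0.
  move=> jk; rewrite /q big1 // => v _; rewrite IHm ?scale0r //.
  exact: leq_trans jk le_km.
(* The lower coefficients vanish, so [a 0 ^+ k] factors out of the relation. It is not in [P 0],
   hence the cofactor [q k + a 0 * w] is, and [a 0] lies in [P 1]. *)
have Pq : P 1%N (q k).
  pose w := \sum_(j : 'I_D | (k < j)%N) a 0%N ^+ (j - k).-1 * q j.
  have sumE : \sum_(j < D) a 0%N ^+ j * q j = a 0%N ^+ k * (q k + a 0%N * w).
    rewrite (bigID (fun j : 'I_D => (j < k)%N)) /= big1 ?add0r; last first.
      by move=> j /qlow ->; rewrite mulr0.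
    rewrite (bigD1 k) ?ltnn //= mulrDr; congr (_ + _).
    rewrite mulrA -exprSr mulr_sumr; apply: eq_big => j.
      by rewrite -leqNgt ltn_neqAle andbC -val_eqE eq_sym.
    rewrite -leqNgt -val_eqE => /andP [kj jk]; rewrite mulrA -exprD.
    by congr (a 0%N ^+ _ * _); move: kj jk => /=; lia.
  have Ppow i : ~ P 0%N (a 0%N ^+ i).
    have [_ _ _ P01 P0M] := P0p.
    elim: i => [|i IHi]; first by rewrite expr0.
    by rewrite exprS => /P0M [].
  have [_ _ _ _ P0M] := P0p; have [_ P1D P1M _ _] := P1p.
  move: Psum; rewrite sumE => /P0M [/Ppow //|/(Pi 0%N isT) h].
  have -> : q k = (q k + a 0%N * w) + (- w) * a 0%N by rewrite mulNr [w * _]mulrC addrK.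
  by apply: P1D => //; apply: P1M.
apply: (IHs (fun i => P i.+1) (fun i => a i.+1)) Pq.
- by move=> i le_is; apply: Pp.
- by move=> i lt_is; apply: Pi.
- by move=> i lt_is; apply: Pa.
Qed.

Definition deg_le d (r : R) := forall b, b \in msupp r -> (mdeg b <= d)%N.

Lemma deg_leM d1 d2 r t : deg_le d1 r -> deg_le d2 t -> deg_le (d1 + d2) (r * t).
Proof.
move=> h1 h2 b /msuppM_le /allpairsP [[b1 b2] /= [/h1 d1' /h2 d2' ->]].
by rewrite mdegD leq_add.
Qed.

Lemma deg_le1 : deg_le 0 1.
Proof. by move=> b; rewrite msupp1 inE => /eqP ->; rewrite mdeg0. Qed.

Lemma deg_le_box s (a : nat -> R) d (u : box s) : (forall i, (i < s)%N -> deg_le d (a i)) ->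
  deg_le (s * (D * d)) (box_mono a u).
Proof.
elim: s a u => [|s IHs] a u ad /=; first exact: deg_le1.
rewrite mulSn; apply: deg_leM; last by apply: IHs => i lt_is; apply: ad.
have pw k : deg_le (k * d) (a 0%N ^+ k).
  elim: k => [|k IHk]; first by rewrite expr0; apply: deg_le1.
  by rewrite exprS mulSn; apply: deg_leM => //; apply: ad.
by move=> b /pw /leq_trans; apply; rewrite leq_mul2r ltnW ?orbT.
Qed.

Lemma kill_vars_box (A : pred 'I_n) s (a : nat -> R) (u : box s) :
  kill_vars A (box_mono a u) = box_mono (fun i => kill_vars A (a i)) u.
Proof.
elim: s a u => [|s IHs] a u /=; first exact: rmorph1.
by rewrite rmorphM rmorphXn /= IHs.
Qed.

End BoxMonomials.

(** * Algebraic dependence modulo the ideal of an edge *)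

Section Dependence.
Variables (K : fieldType) (n : nat) (i j : 'I_n).
Local Notation R := {mpoly K[n]}.
Hypothesis neq_ij : i != j.
Let A : pred 'I_n := [pred l | (l == i) || (l == j)].
Let I := {l : 'I_n | ~~ A l}.

Lemma card_free_vars : #|{: I}| = (n - 2)%N.
Proof.
rewrite card_sig; have := cardC A; rewrite card_ord.
have -> : #|A| = 2%N by have := cards2 i j; rewrite neq_ij => <-; apply: eq_card => l; rewrite !inE.
have -> : #|[predC A]| = #|[pred l | ~~ A l]| by apply: eq_card => l; rewrite !inE.
by lia.
Qed.

(** A dimension count: modulo [A] only [n - 2] variables remain, so for large [D] the [D ^ (n - 1)]
    products outnumber the monomials that can occur in them. *)
Lemma algebraic_dependence (a : nat -> R) : (0 < n.-1)%N ->
  exists (D : nat) (c : box D n.-1 -> K),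
    (exists u, c u != 0) /\ vars_ideal A (\sum_u c u *: box_mono a u).
Proof.
move=> n1; pose s := n.-1.
pose d := (\max_(t < s) msize (a t))%N.
have ad t : (t < s)%N -> deg_le d (a t).
  move=> ts b /msize_mdeg_lt /ltnW /leq_trans; apply.
  exact: (leq_bigmax (Ordinal ts)).
(* [B] bounds the degrees of all products. As [B + 1 <= D (s d + 1)], the inequality
   [(B + 1)^(s-1) < D^s] follows from [(s d + 1)^(s-1) < D]. *)
pose D := ((s * d).+1 ^ s).+1; pose B := (s * (D * d))%N.
pose V := {ffun I -> 'I_B.+1}.
pose mn (v : V) : 'X_{1..n} := [multinom (if insub l is Some x then v x : nat else 0%N) | l < n].
have cardV : (#|{: V}| < #|box D s|)%N.
  rewrite card_box card_ffun card_ord card_free_vars.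
  have s1 : (0 < s)%N by [].
  have -> : (n - 2 = s.-1)%N by rewrite /s -subn1 -subn1 -subnDA.
  have le_B : (B.+1 <= D * (s * d).+1)%N by rewrite /B mulnCA mulnS; lia.
  apply: (@leq_ltn_trans ((D * (s * d).+1) ^ s.-1)%N).
    by case: (s.-1) => // k; rewrite leq_exp2r.
  rewrite expnMn -[in X in (_ < X)%N](prednK s1) expnSr ltn_pmul2l ?expn_gt0 //.
  by rewrite ltnS leq_pexp2l // leq_pred.
exists D.
(* Rows are the coefficient vectors of the products modulo [A]; there are more rows than columns, so
   the left kernel is nonzero. *)
pose N := \matrix_(u < #|box D s|, v < #|{: V}|) (box_mono (fun t => kill_vars A (a t)) (enum_val u))@_(mn (enum_val v)).
have : kermx N != 0.
  rewrite kermx_eq0; apply: contraTneq cardV => rN.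
  by rewrite -leqNgt -[X in (X <= _)%N]rN rank_leq_col.
case/matrix0Pn => r [u0 nz].
exists (fun u => kermx N r (enum_rank u)); split; first by exists (enum_val u0); rewrite enum_valK.
apply/kill_varsP; rewrite raddf_sum /=.
apply/mpolyP => b; rewrite mcoeff0 raddf_sum /=.
have kZ c f : kill_vars A (c *: f) = c *: kill_vars A f.
  by rewrite -!mul_mpolyC rmorphM /= [kill_vars _ c%:MP]mmapC.
rewrite (eq_bigr (fun u => kermx N r (enum_rank u) * (box_mono (fun t => kill_vars A (a t)) u)@_b)); last first.
  by move=> u _; rewrite kZ kill_vars_box mcoeffZ.
(* Monomials not indexed by [V] have coefficient [0], either because they contain a killed variable
   or by the degree bound [B]. *)
have [bA|bA] := boolP ([forall l, A l ==> (b l == 0%N)] && [forall l, (b l <= B)%N]); last first.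
  rewrite big1 // => u _; apply/eqP; rewrite mulf_eq0; apply/orP; right.
  rewrite -kill_vars_box mcoeff_kill_vars; case: ifP => // bA'.
  move: bA; rewrite bA' /= negb_forall => /existsP [l]; rewrite -ltnNge => lB.
  rewrite mcoeff_eq0; apply: contraTN lB => /(deg_le_box (s := s) ad) db; rewrite -leqNgt.
  by apply: leq_trans db; rewrite mdegE (bigD1 l) //= leq_addr.
case/andP: bA => /forallP bA /forallP bB.
pose v : V := [ffun x : I => inord (b (val x))].
have -> : b = mn v.
  apply/mnmP => l; rewrite mnmE; case: insubP => [x _ xl|].
    by rewrite ffunE inordK ?xl // ltnS bB.
  by rewrite negbK => Al; have := bA l; rewrite Al => /eqP.
have : (kermx N *m N) r (enum_rank v) = 0 by rewrite mulmx_ker mxE.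
rewrite mxE => sum0; apply: etrans sum0.
rewrite [RHS](reindex (@enum_rank (box D s))) /=; last exact/onW_bij/enum_rank_bij.
by apply: eq_bigr => u _; congr (_ * _); rewrite [RHS]mxE !enum_rankK.
Qed.

End Dependence.

(** * The dimension of the quotient by the cover ideal *)

Section Dimension.
Variables (K : fieldType) (n : nat) (e : rel 'I_n) (x0 xn : 'I_n).
Local Notation R := {mpoly K[n]}.
Local Notation J := (@cover_ideal K n e).
Hypothesis n_ge2 : (2 <= n)%N.
Hypothesis e_irr : irreflexive e.
Hypothesis e0n : e x0 xn.
Hypotheses (x0E : x0 = 0%N :> nat) (xnE : xn = n.-1 :> nat).

Lemma vars_ideal_sub (A B : pred 'I_n) (r : R) : (forall l, A l -> B l) ->
  vars_ideal A r -> vars_ideal B r.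
Proof. by move=> AB rA b bB; apply: rA => l /AB; apply: bB. Qed.

(** The chain starts at the prime of the edge joining [x0] and [xn], the first and last variables,
    and adjoins the others in order up to the maximal ideal. *)
Lemma cover_chain : prime_chain J (n - 2)
  (fun i => vars_ideal [pred l : 'I_n | (l == xn) || (l <= i)%N]).
Proof.
split=> [i _|i _ a Ja|i lt_in]; first exact: vars_ideal_prime.
  apply: vars_ideal_sub (span_vars_ideal (Ja _ _ e0n)) => l /= /orP [] /eqP ->.
    by rewrite x0E orbT.
  by rewrite eqxx.
split=> [a|].
  apply: vars_ideal_sub => l /= /orP [->//|li]; by rewrite (leqW li) orbT.
have lt_Sin : (i.+1 < n)%N by lia.
exists 'X_(Ordinal lt_Sin) => [b bA|].
  rewrite mcoeffX; case: eqP => // bE; have := bA (Ordinal lt_Sin).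
  by rewrite /= leqnn orbT -bE mnm1E eqxx => /(_ isT).
move=> /(_ U_(Ordinal lt_Sin)%MM); rewrite mcoeffX eqxx => h.
suff : (1 : K) = 0 by move/eqP; rewrite oner_eq0.
apply: h => l /orP [/eqP ->|li]; rewrite mnm1E -val_eqE /=.
  by rewrite xnE; case: eqP => // h; lia.
by case: eqP => // h; move: li => /=; lia.
Qed.

(** The product of the variables outside [P] is not in [P], hence not in [J]; so some edge has both
    its variables in [P]. *)
Lemma prime_over_cover (P : R -> Prop) : is_prime_ideal P -> (forall a, J a -> P a) ->
  exists i j, e i j /\ forall r, vars_ideal [pred l | (l == i) || (l == j)] r -> P r.
Proof.
move=> [P0 PD PM P1 Pp] JP.
pose b : 'X_{1..n} := [multinom (~~ `[< P ('X_l : R) >] : nat) | l < n].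
have nPb : ~ P 'X_[b].
  rewrite mpolyXE_id; apply: (big_ind (fun r => ~ P r)) => // [r t nr nt /Pp []//|l _].
  by rewrite mnmE; case: asboolP => [_|nPl]; rewrite ?expr0 ?expr1.
have [i [j [eij Pi Pj]]] : exists i j, [/\ e i j, P 'X_i & P 'X_j].
  apply: contrapT => nE; apply: nPb; apply: JP; apply: cover_mono => i j eij.
  rewrite !mnmE; case: asboolP => // Pi; case: asboolP => // Pj.
  by case: nE; exists i, j.
exists i, j; split=> // r rij; rewrite [r]mpolyE big_seq; apply: big_ind => // b' b'r.
have [/existsP [l /andP [lij bl]]|nl] := boolP [exists l, ((l == i) || (l == j)) && (b' l != 0%N)].
  rewrite -lep1mP in bl; rewrite -(submK bl) mpolyXD -mul_mpolyC mulrA.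
  by apply: PM; case/orP: lij => /eqP ->.
move: b'r; rewrite mcoeff_msupp rij ?eqxx // => l lij.
by apply/eqP; apply: contraNT nl => bl; apply/existsP; exists l; apply/andP.
Qed.

(** A longer chain would give [n - 1] elements algebraically independent modulo its first prime,
    which contains the ideal of an edge; this contradicts [algebraic_dependence]. *)
Lemma cover_dim : krull_dim_quotient J (n - 2).
Proof.
split; first by eexists; apply: cover_chain.
move=> l P [Pp JP Pi]; rewrite leqNgt; apply/negP => lt_l.
have n1 : (0 < n.-1)%N by lia.
have sl : (n.-1 <= l)%N by lia.
have [i [j [eij Pij]]] := prime_over_cover (Pp 0%N isT) (JP 0%N isT).
have neq_ij : i != j by apply/eqP => ij; rewrite ij e_irr in eij.
have /choice [a aP] (t : nat) : exists r : R, (t < n.-1)%N -> P t.+1 r /\ ~ P t r.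
  have [ts|_] := ltnP t n.-1; last by exists 0.
  by have [_ [r Pr nPr]] := Pi t (leq_trans ts sl); exists r.
have [D [c [[u nz] rel]]] := algebraic_dependence neq_ij a n1.
case/eqP: nz; apply: (@chain_independent K n D n.-1 P a c) => //.
- by move=> t ts; apply: Pp; apply: leq_trans ts sl.
- by move=> t ts; have [] := Pi t (leq_trans ts sl).
- exact: Pij.
Qed.

End Dimension.

Local Close Scope ring_scope.
(* [mpoly] and [classical_sets] shadow [symmetric], [subsetP] and [inE]. *)
From mathcomp Require Import all_boot.

Theorem proposition3p8 (K : fieldType) (n : nat) (e : rel 'I_n) (xn : 'I_n)
    (n_ge2 : 2 <= n)
    (e_sym : symmetric e) (e_irr : irreflexive e)
    (e_conn : forall i j : 'I_n, connect e i j)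
    (xn_last : nat_of_ord xn = n.-1)
    (xn_deg : #|[set j | e xn j]| = n.-1) :
  trivial_lyubeznik_table (cover_ideal K e).
Proof.
(* The neighbourhood of [xn] avoids [xn] and has [n - 1] elements, so it is the rest of the vertex
   set. *)
have dom j : j != xn -> e xn j.
  have /eqP /setP /(_ j) : [set j | e xn j] == [set~ xn].
    rewrite eqEcard xn_deg cardsC1 card_ord leqnn andbT.
    by apply/subsetP => k; rewrite !inE; apply: contraTneq => ->; rewrite e_irr.
  by rewrite !inE => ->.
pose x0 : 'I_n := Ordinal (ltnW n_ge2).
have neq_x0n : x0 != xn by rewrite -val_eqE /= xn_last; lia.
have e0n : e x0 xn by rewrite e_sym dom.
have [H JH [h0 [xn_onto x0_onto h0_gen h0_ann]]] :=
  local_cohomology_two K e_irr dom neq_x0n.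
exists (n - 2); split.
- exact: (@cover_dim K n e x0 xn).
- exists H; first by rewrite subKn.
  exact: (bass_number_top neq_x0n xn_onto x0_onto h0_gen h0_ann).
(* For [i = n - 2] the module is again [H^2_J(R)]; for smaller [i] the cohomological degree [n - i]
   is at least [3], where ['X_xn] is bijective. *)
- move=> p i le_pi le_id neq_pi; have [id|neq_id] := eqVneq i (n - 2).
    exists H; first by rewrite id subKn.
    apply: (bass_number_below neq_x0n xn_onto x0_onto h0_gen h0_ann) => pd.
    by apply: neq_pi; rewrite pd id.
  have [H' JH' [inj onto]] := local_cohomology_high K e_irr dom neq_x0n (n - i - 3).
  exists H'; last exact: (bass_number_bijective neq_x0n p inj onto).
  by have -> : n - i = (n - i - 3).+3 by lia.
Qed.
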